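(* Suppose that the general assumptions (G1)--(G6) and the smoothness assumptions (S1)--(S3) listed in the context hold, that $\Xi$ is the support of $\mathbb{P}$, and that $\mathcal{K}$ has nonempty interior. Let $(u_N^*,\lambda_N^* )\subset U\times\mathcal{C}(\Xi;R)^*$ be a sequence satisfying, for each $N\in\mathbb{N}$, the SAA KKT conditions $$0\in D\widehat{F}_N(u_N^* )+\partial\psi(u_N^* )+D\mathcal{G}(u_N^* )^*\lambda_N^*,\quad \lambda_N^*\in\mathcal{K}^-,\quad \langle\lambda_N^*,\mathcal{G}(u_N^* )\rangle=0,\quad \mathcal{G}(u_N^* )(\xi^i)\in K,\ i=1,\ldots,N.$$ Suppose that, w.p.1, $u_N^*\rightharpoonup^*\bar u$, where $\bar u$ is such that there exists $\hat u\in\mathrm{dom}(\psi)$ with $$\mathcal{G}(\bar u)+D\mathcal{G}(\bar u)(\hat u-\bar u)\in\mathrm{int}(\mathcal{K}).$$ Then, w.p.1, weak$^*$ limits (along subsequences) of $(u_N^*,\lambda_N^* )$ are KKT points of problem (P).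
   Context: Probabilistic setting: $(\Omega,\mathcal{F},P)$ is a complete probability space; $\Xi$ is a complete separable metric space with its Borel $\sigma$-algebra; $\xi\colon\Omega\to\Xi$ is a random element whose law $\mathbb{P}$ is assumed complete; $\xi^1,\xi^2,\ldots$ are independent $\Xi$-valued random elements on $(\Omega,\mathcal{F},P)$, each with law $\mathbb{P}$; $\mathbb{E}$ denotes expectation. The support of $\mathbb{P}$ is the intersection of all closed sets of probability one. ''W.p.1'' means for $P$-a.e. $\omega\in\Omega$; dependence on $\omega$ is suppressed. General assumptions: (G1) $W$, $R$, $R_0$ are real separable Banach spaces with $R\subset R_0$, and $U$ is the dual of a real separable Banach space. (G2) $B\colon U\to W$ is linear and sequentially weakly$^*$-to-strongly continuous ($u_N\rightharpoonup^* u$ implies $Bu_N\to Bu$ in $W$). (G3) $\mathscr{J}\colon W\times\Xi\to[0,\infty)$ is random lower semicontinuous, i.e., $\xi\mapsto\{(w,t)\in W\times\mathbb{R}\mid \mathscr{J}(w,\xi)\le t\}$ is a random closed set (a measurable closed-valued multifunction). (G4) $\mathscr{G}\colon W\times\Xi\to R_0$ is Carath\'eodory (continuous in the first argument, measurable in the second), $\mathscr{G}(Bu,\xi)\in R$ for all $(u,\xi)\in U\times\Xi$, and $\mathscr{G}\colon B(\mathrm{dom}(\psi))\times\Xi\to R$ is Carath\'eodory. Moreover, $K\subset R$ is a nonempty, closed, convex cone. (G5) $\psi\colon U\to[0,\infty]$ is proper, convex, and sequentially weakly$^*$ lower semicontinuous, with a bounded, weakly$^*$ sequentially closed domain $\mathrm{dom}(\psi)=\{u\in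 U\mid\psi(u)<\infty\}$. (G6) Problem (P) below has a feasible point with finite objective function value. Smoothness assumptions: (S1) The metric space $\Xi$ is compact. (S2) $U_0\subset U$ and $W_0\subset W$ are open sets with $\mathrm{dom}(\psi)\subset U_0$ and $B(U_0)\subset W_0$. For all $\xi\in\Xi$, $\mathscr{J}(\cdot,\xi)$ is continuously differentiable on $W_0$, and for all $w\in W_0$, $D_w\mathscr{J}(w,\cdot)$ is measurable. Moreover, there is an integrable $L\colon\Xi\to[0,\infty)$ with $\|D_w\mathscr{J}(w,\xi)\|\le L(\xi)$ for all $(w,\xi)\in W_0\times\Xi$. (S3) For each $\xi\in\Xi$, $\mathscr{G}(\cdot,\xi)$ is continuously differentiable on $W_0$, and for all $w\in W_0$, $D_w\mathscr{G}(w,\cdot)$ is measurable. Moreover, $\mathscr{G}\colon B(U_0)\times\Xi\to R$ and $D_w\mathscr{G}\colon B(U_0)\times\Xi\to\mathscr{L}(W,R)$ (bounded linear operators from $W$ to $R$) are continuous. Notation: $J(u,\xi):=\mathscr{J}(Bu,\xi)$, $G(u,\xi):=\mathscr{G}(Bu,\xi)$, $F\colon U\to[0,\infty)$, $F(u):=\mathbb{E}[J(u,\xi)]$, $\widehat{F}_N(u):=\frac1N\sum_{i=1}^N J(u,\xi^i)$. $D$ denotes the Fr\'echet derivative and $\partial\psi$ the convex subdifferential. $\mathcal{C}(\Xi;R)$ is the space of continuous functions $\Xi\to R$ with the supremum norm; $\mathcal{G}\colon U_0\to\mathcal{C}(\Xi;R)$, $\mathcal{G}(u):=G(u,\cdot)$,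 is continuously differentiable with $D\mathcal{G}(u)=D_uG(u,\cdot)$ and adjoint $D\mathcal{G}(u)^*\colon\mathcal{C}(\Xi;R)^*\to U^*$. $\mathcal{K}:=\{r\in\mathcal{C}(\Xi;R)\mid r(\xi)\in K\ \text{for all}\ \xi\in\Xi\}$, and $\mathcal{K}^-:=\{\lambda\in\mathcal{C}(\Xi;R)^*\mid\langle\lambda,k\rangle\le0\ \text{for all}\ k\in\mathcal{K}\}$. Problem (P): $\min_{u\in U} F(u)+\psi(u)$ subject to $G(u,\xi)\in K$ for $\mathbb{P}$-a.e. $\xi\in\Xi$. A KKT point of (P) is a pair $(u,\lambda)\in U\times\mathcal{C}(\Xi;R)^*$ with $\mathcal{G}(u)\in\mathcal{K}$, $0\in DF(u)+\partial\psi(u)+D\mathcal{G}(u)^*\lambda$, $\lambda\in\mathcal{K}^-$, and $\langle\lambda,\mathcal{G}(u)\rangle=0$. *)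

(* Defs.v *)
From HB Require Import structures.
From mathcomp Require Import all_boot all_order all_algebra.
From mathcomp Require Import all_classical all_reals all_analysis.

Set Implicit Arguments.
Unset Strict Implicit.
Unset Printing Implicit Defensive.

Import Order.TTheory GRing.Theory Num.Theory.
Import numFieldNormedType.Exports.

Local Open Scope classical_set_scope.
Local Open Scope ring_scope.

(* A complete metric space that also carries a sigma-algebra; the two
   structures are tied together only by [borel_completion] below. *)
#[short(type="measurableMetricType")]
HB.structure Definition MeasurableMetric (R : numDomainType) d :=
  {T of Metric R T & Complete T & Measurable d T}.

Section bounded_operators.
Context {R : realType} (V W : normedModType R).

Definition bop_pred : {pred V -> W} :=
  fun f => `[< linear f /\ continuous f >].

Record bop := Bop { bop_val :> V -> W ; bop_valP : bop_val \in bop_pred }.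

HB.instance Definition _ := [isSub of bop for bop_val].
HB.instance Definition _ := [Choice of bop by <:].

Lemma bop_submod : submod_closed bop_pred.
Proof.
split.
  apply/asboolP; split; last by move=> x; exact: cvg_cst.
  by move=> a x y; rewrite /= scaler0 addr0.
move=> a f g /asboolP[lf cf] /asboolP[lg cg]; apply/asboolP; split.
  move=> b x y; rewrite /= !fctE lf lg !scalerDr !scalerA.
  by rewrite (mulrC a b) addrACA.
by move=> x; apply: cvgD; [apply: cvgZl_tmp; exact: cf | exact: cg].
Qed.

HB.instance Definition _ := GRing.isSubmodClosed.Build _ _ bop_pred bop_submod.
HB.instance Definition _ := [SubChoice_isSubLmodule of bop by <:].

Lemma bop_linear (f : bop) : linear f.
Proof. by case: f => f /= /asboolP[]. Qed.

Lemma bop_continuous (f : bop) : continuous f.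
Proof. by case: f => f /= /asboolP[]. Qed.

HB.instance Definition _ (f : bop) :=
  GRing.isLinear.Build R V W *:%R (bop_val f) (bop_linear f).

Definition bop_norm (f : bop) : R :=
  sup [set `|f x| | x in [set x : V | `|x| <= 1]].

Lemma bop_has_sup (f : bop) :
  has_sup [set `|f x| | x in [set x : V | `|x| <= 1]].
Proof.
split; first by exists `|f 0|, 0 => //=; rewrite normr0.
have /linear_bounded_continuous/bounded_funP/(_ 1)[M fM] : continuous f
  by exact: bop_continuous.
by exists M => _ [x /= x1 <-]; exact: fM.
Qed.

Lemma bop_norm_ge (f : bop) x : `|f x| <= bop_norm f * `|x|.
Proof.
have [->|x0] := eqVneq x 0; first by rewrite linear0 !normr0 mulr0.
have nx0 : 0 < `|x| by rewrite normr_gt0.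
rewrite -ler_pdivrMr// mulrC.
have -> : `|x|^-1 * `|f x| = `|f (`|x|^-1 *: x)|.
  by rewrite linearZ normrZ gtr0_norm ?invr_gt0.
apply: sup_ubound; first by case: (bop_has_sup f).
exists (`|x|^-1 *: x) => //=.
by rewrite normrZ gtr0_norm ?invr_gt0// mulVf// gt_eqF.
Qed.

Lemma bop_norm_le (f : bop) M :
  (forall x, `|x| <= 1 -> `|f x| <= M) -> bop_norm f <= M.
Proof.
move=> fM; apply: ge_sup; first by case: (bop_has_sup f).
by move=> _ [x /= x1 <-]; exact: fM.
Qed.

Lemma bop_norm_ge0 (f : bop) : 0 <= bop_norm f.
Proof.
apply: le_trans (_ : `|f 0| <= _) => //; apply: sup_ubound.
  by case: (bop_has_sup f).
by exists 0 => //=; rewrite normr0.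
Qed.

Lemma bop_norm_le1 (f : bop) x : `|x| <= 1 -> `|f x| <= bop_norm f.
Proof.
move=> x1; apply: le_trans (bop_norm_ge f x) _.
by rewrite ler_piMr// bop_norm_ge0.
Qed.

Lemma bop_normD f g : bop_norm (f + g) <= bop_norm f + bop_norm g.
Proof.
apply: bop_norm_le => x x1; apply: le_trans (ler_normD _ _) _.
by apply: lerD; exact: bop_norm_le1.
Qed.

Lemma bop_normZ_le a f : bop_norm (a *: f) <= `|a| * bop_norm f.
Proof.
apply: bop_norm_le => x x1.
by rewrite [_ x]/(a *: f x) normrZ ler_wpM2l// bop_norm_le1.
Qed.

Lemma bop_normZ a f : bop_norm (a *: f) = `|a| * bop_norm f.
Proof.
apply/eqP; rewrite eq_le bop_normZ_le /=.
have [->|a0] := eqVneq a 0; first by rewrite normr0 mul0r bop_norm_ge0.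
rewrite -ler_pdivlMl ?normr_gt0// -normfV.
by apply: le_trans (bop_normZ_le _ _); rewrite scalerA mulVf// scale1r.
Qed.

Lemma bop_norm0_eq0 f : bop_norm f = 0 -> f = 0.
Proof.
move=> f0; apply/val_inj/funext => x /=; apply/eqP; rewrite -normr_le0.
by apply: le_trans (bop_norm_ge f x) _; rewrite f0 mul0r.
Qed.

HB.instance Definition _ :=
  Lmodule_isNormed.Build R bop bop_normD bop_normZ bop_norm0_eq0.

End bounded_operators.

Definition dual {R : realType} (V : normedModType R) := bop V R^o.

Definition contfun_pred {R : realType} {X : topologicalType}
  {E : normedModType R} : {pred X -> E} := fun f => `[< continuous f >].

(* The argument [hX] makes the supremum norm finite. *)
Record contfun {R : realType} {X : topologicalType} (hX : compact [set: X])
    (E : normedModType R) := ContFun {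
  contfun_val :> X -> E ;
  contfun_valP : contfun_val \in contfun_pred }.

Section continuous_functions.
Context {R : realType} {X : topologicalType} (hX : compact [set: X]).
Context (E : normedModType R).

Local Notation contfun := (contfun hX E).
Local Notation contfun_pred := (@contfun_pred R X E).

HB.instance Definition _ := [isSub of contfun for @contfun_val R X hX E].
HB.instance Definition _ := [Choice of contfun by <:].

Lemma contfun_submod : submod_closed contfun_pred.
Proof.
split; first by apply/asboolP => x; exact: cvg_cst.
move=> a f g /asboolP cf /asboolP cg; apply/asboolP => x.
by apply: cvgD; [apply: cvgZl_tmp; exact: cf | exact: cg].
Qed.

HB.instance Definition _ :=
  GRing.isSubmodClosed.Build _ _ contfun_pred contfun_submod.
HB.instance Definition _ := [SubChoice_isSubLmodule of contfun by <:].

Lemma contfun_continuous (f : contfun) : continuous f.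
Proof. by case: f => f /= /asboolP. Qed.

Definition contfun_norm (f : contfun) : R := sup (range (fun x => `|f x|)).

Lemma contfun_has_ubound (f : contfun) : has_ubound (range (fun x => `|f x|)).
Proof.
have /compact_bounded[M [_ fM]] : compact (f @` [set: X]).
  apply: continuous_compact => //.
  exact/continuous_subspaceT/contfun_continuous.
exists (M + 1) => _ [x _ <-]; apply: (fM (M + 1)); last by exists x.
by rewrite ltrDl.
Qed.

Lemma contfun_norm_ge (f : contfun) x : `|f x| <= contfun_norm f.
Proof. by apply: (sup_ubound (contfun_has_ubound f)); exists x. Qed.

Lemma contfun_norm_le (f : contfun) M : 0 <= M ->
  (forall x, `|f x| <= M) -> contfun_norm f <= M.
Proof.
move=> M0 fM; rewrite /contfun_norm.
have [->|/set0P r0] := eqVneq (range (fun x => `|f x|)) set0.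
  by rewrite sup0.
by apply: ge_sup => // _ [x _ <-]; exact: fM.
Qed.

Lemma contfun_norm_ge0 (f : contfun) : 0 <= contfun_norm f.
Proof.
rewrite /contfun_norm.
have [->|/set0P[_ [x _ _]]] := eqVneq (range (fun x => `|f x|)) set0.
  by rewrite sup0.
exact: le_trans (normr_ge0 (f x)) (contfun_norm_ge f x).
Qed.

Lemma contfun_normD f g :
  contfun_norm (f + g) <= contfun_norm f + contfun_norm g.
Proof.
apply: contfun_norm_le => [|x]; first by rewrite addr_ge0 ?contfun_norm_ge0.
by apply: le_trans (ler_normD _ _) _; apply: lerD; exact: contfun_norm_ge.
Qed.

Lemma contfun_normZ_le a f : contfun_norm (a *: f) <= `|a| * contfun_norm f.
Proof.
apply: contfun_norm_le => [|x]; first by rewrite mulr_ge0 ?contfun_norm_ge0.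
by rewrite [_ x]/(a *: f x) normrZ ler_wpM2l// contfun_norm_ge.
Qed.

Lemma contfun_normZ a f : contfun_norm (a *: f) = `|a| * contfun_norm f.
Proof.
apply/eqP; rewrite eq_le contfun_normZ_le /=.
have [->|a0] := eqVneq a 0; first by rewrite normr0 mul0r contfun_norm_ge0.
rewrite -ler_pdivlMl ?normr_gt0// -normfV.
by apply: le_trans (contfun_normZ_le _ _); rewrite scalerA mulVf// scale1r.
Qed.

Lemma contfun_norm0_eq0 f : contfun_norm f = 0 -> f = 0.
Proof.
move=> f0; apply/val_inj/funext => x /=; apply/eqP; rewrite -normr_le0 -f0.
exact: contfun_norm_ge.
Qed.

HB.instance Definition _ := Lmodule_isNormed.Build R contfun
  contfun_normD contfun_normZ contfun_norm0_eq0.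

End continuous_functions.

Section functional_analysis.
Context {R : realType}.

Definition separable (T : topologicalType) :=
  exists2 D : set T, countable D & dense D.

Definition weakstar_cvg (V : normedModType R) (u : nat -> dual V)
    (l : dual V) :=
  forall v, (fun n => u n v) @ \oo --> l v.

Lemma bop_comp_subproof (U V W : normedModType R) (g : bop V W) (f : bop U V) :
  g \o f \in @bop_pred R U W.
Proof.
apply/asboolP; split=> [a x y|x] /=; first by rewrite !linearP.
by apply: continuous_comp; exact: bop_continuous.
Qed.

Definition adjoint (V W : normedModType R) (T : bop V W) (l : dual W) :
  dual V := Bop (bop_comp_subproof l T).

(* The differential as an element of the space of bounded operators; its value
   is 0 when ['d f x] is not continuous, hence never at a point where [f] is
   differentiable. *)
Definition frechet (V W : normedModType R) (f : V -> W) (x : V) : bop V W :=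
  insubd (0 : bop V W) ('d f x : V -> W).

Definition continuously_differentiable_on (V W : normedModType R) (A : set V)
    (f : V -> W) :=
  (forall x, A x -> differentiable f x) /\ {within A, continuous (frechet f)}.

Definition dom (V : Type) (psi : V -> \bar R) : set V :=
  [set u | (psi u < +oo)%E].

Definition econvex (V : lmodType R) (psi : V -> \bar R) :=
  forall (t : R) (u v : V), 0 <= t <= 1 ->
    (psi (t *: u + (1 - t) *: v)%R
     <= t%:E * psi u + (1 - t)%R%:E * psi v)%E.

Definition weakstar_seq_lsc (V : normedModType R) (psi : dual V -> \bar R) :=
  forall u l, weakstar_cvg u l -> (psi l <= limn_einf (psi \o u))%E.

Definition weakstar_seq_closed (V : normedModType R) (A : set (dual V)) :=
  forall u l, (forall n, A (u n)) -> weakstar_cvg u l -> A l.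

Definition subdifferential (V : normedModType R) (psi : V -> \bar R) (u : V) :
    set (dual V) :=
  [set mu | dom psi u /\ forall v, (psi u + (mu (v - u)%R)%:E <= psi v)%E].

Definition cone (V : lmodType R) (K : set V) :=
  forall (t : R) x, 0 < t -> K x -> K (t *: x).

Definition polar (V : normedModType R) (K : set V) : set (dual V) :=
  [set l | forall k, K k -> l k <= 0].

End functional_analysis.

Section probability.
Context {R : realType}.

(* The sigma-algebra of [X] is the completion, with respect to the measure
   [mu], of the Borel sigma-algebra [<<s open >>]. *)
Definition borel_completion d (X : measurableMetricType R d)
    (mu : set X -> \bar R) :=
  forall A : set X, measurable A <->
    exists B C : set X, [/\ <<s open >> B, <<s open >> C,
      B `<=` A, A `<=` C & mu (C `\` B) = 0%E].

Definition borel (T : ptopologicalType) := g_sigma_algebraType (@open T).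

Definition borel_measurable d (X : measurableType d) (T : ptopologicalType)
    (f : X -> T) :=
  measurable_fun [set: X] (f : X -> borel T).

Definition caratheodory_on d (X : measurableType d) (V : topologicalType)
    (T : ptopologicalType) (A : set V) (f : V -> X -> T) :=
  (forall x, {within A, continuous (f ^~ x)}) /\
  (forall v, A v -> borel_measurable (f v)).

Definition random_closed_set d (X : measurableType d) (T : topologicalType)
    (S : X -> set T) :=
  (forall x, closed (S x)) /\
  (forall O : set T, open O -> measurable [set x | S x `&` O !=set0]).

Definition random_lsc d (X : measurableType d) (W : normedModType R)
    (J : W -> X -> R) :=
  random_closed_set (fun x => [set p : W * R^o | J p.1 x <= p.2]).

Definition independent d (Omega : measurableType d) (P : probability Omega R)
    d' (X : measurableType d') (xs : nat -> {RV P >-> X}) :=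
  forall (s : seq nat) (A : nat -> set X), uniq s ->
    (forall i, measurable (A i)) ->
    P (\big[setI/setT]_(i <- s) (xs i @^-1` A i)) =
    (\prod_(i <- s) P (xs i @^-1` A i))%E.

Definition law_support d (X : measurableMetricType R d) (mu : set X -> \bar R) :
    set X :=
  \bigcap_(C in [set C : set X | closed C /\ mu C = 1%E]) C.

End probability.

Section program.
Context {R : realType} {d d' : measure_display}.
Context {Omega : measurableType d} {P : probability Omega R}.
Context {Xi : measurableMetricType R d'} (hXi : compact [set: Xi]).
Context {Z W E E0 : normedModType R}.
(* [iota] is the inclusion of [E] into [E0]. *)
Context (iota : E -> E0) (B : dual Z -> W).

(* The element of [E] that [y] is, when [y] lies in the range of [iota]. *)
Definition in_sub (y : E0) : E := get (fun e => iota e = y).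

(* The function [xi |-> GG (B u) xi] seen as an element of C(Xi; E); it is 0
   when this function is not continuous. *)
Definition calG (GG : W -> Xi -> E0) (u : dual Z) : contfun hXi E :=
  insubd (0 : contfun hXi E) (fun x => in_sub (GG (B u) x)).

Definition calK (K : set E) : set (contfun hXi E) :=
  [set r | forall x, K (r x)].

Definition eF (J : W -> Xi -> R) (xi : {RV P >-> Xi}) (u : dual Z) : \bar R :=
  'E_P[fun w => J (B u) (xi w)]%E.

Definition F (J : W -> Xi -> R) (xi : {RV P >-> Xi}) (u : dual Z) : R^o :=
  fine (eF J xi u).

(* The sample [xi^1, xi^2, ...] is numbered from 0. *)
Definition Fhat (J : W -> Xi -> R) (xis : nat -> {RV P >-> Xi}) (N : nat)
    (w : Omega) (u : dual Z) : R^o :=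
  N%:R^-1 * \sum_(i < N) J (B u) (xis i w).

Definition stationary (C : normedModType R) (f : dual Z -> R^o)
    (psi : dual Z -> \bar R) (g : dual Z -> C) (u : dual Z) (l : dual C) :=
  exists2 mu : dual (dual Z), subdifferential psi u mu &
    frechet f u + mu + adjoint (frechet g u) l = 0.

Definition KKT_point (J : W -> Xi -> R) (xi : {RV P >-> Xi})
    (psi : dual Z -> \bar R) (GG : W -> Xi -> E0) (K : set E)
    (u : dual Z) (l : dual (contfun hXi E)) :=
  [/\ differentiable (F J xi) u, differentiable (calG GG) u &
  [/\ calK K (calG GG u),
      stationary (F J xi) psi (calG GG) u l,
      polar (calK K) l &
      l (calG GG u) = 0]].

Definition SAA_KKT_point (J : W -> Xi -> R) (xis : nat -> {RV P >-> Xi})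
    (psi : dual Z -> \bar R) (GG : W -> Xi -> E0) (K : set E)
    (N : nat) (w : Omega) (u : dual Z) (l : dual (contfun hXi E)) :=
  [/\ stationary (Fhat J xis N w) psi (calG GG) u l,
      polar (calK K) l,
      l (calG GG u) = 0 &
      forall i : 'I_N, K (calG GG u (xis i w))].

End program.

Arguments calK {R d' Xi} hXi {E} K _.

(* Main.v *)
Require Import Defs.
From HB Require Import structures.
From mathcomp Require Import all_boot all_order all_algebra.
From mathcomp Require Import all_classical all_reals all_analysis.
From mathcomp Require Import measurable_realfun ring lra.

(** Almost surely the laws of large numbers used below hold for countably many
    functions at once; fix such an outcome. A weak* limit u of
    the u_n stays in dom psi, and B turns weak* convergence into norm
    convergence, so whatever depends on u only through B u converges strongly
    along the subsequence. It remains to pass to the limit in each line of the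
    optimality conditions.

    Feasibility. Every ball has positive mass because Xi is the support, so
    almost surely the sample is dense ([sample_dense]). At a fixed sample point
    the constraint holds from some index on; it survives the limit since
    calG (u_n) converges to calG u uniformly, and it extends from the sample to
    all of Xi by continuity.

    Multipliers. An interior point r of calK controls the whole polar cone: the
    norm of l is at most a constant times - l r ([polar_bounded]). Weak*
    convergence at the single point r thus bounds the multipliers, and pairings
    of weak* convergent multipliers with norm convergent functions converge
    ([dual_pairing_cvg]). This settles complementarity and the multiplier term
    of the stationarity condition tested against v - u_n.

    Objective. The derivative of the sample average at u_n is an average of
    derivatives taken at B u_n, a point that itself depends on the sample, and
    the limit B u is random too. Since W is separable and the derivatives are
    dominated by L, suprema of the derivative over small balls centred in a
    dense sequence form a countable family of integrable functions, to which the
    strong law applies simultaneously; as the balls shrink around B u, continuity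
    and dominated convergence bring their means back to the derivative at B u
    ([uniform_law_of_large_numbers]). Stationarity is then the limit of the
    subgradient inequality, by lower semicontinuity of psi
    ([subdifferential_limit]).

    Three facts feed this argument. The strong law ([strong_law]) is obtained
    from pairwise independence: truncate at a geometric scale, use Chebyshev's
    inequality and Borel-Cantelli along a geometric sequence of sample sizes, and
    interpolate by monotonicity. The expected objective is differentiable by
    dominated convergence ([expectation_frechet]). The map calG is differentiable
    into C(Xi; E) although GG is only known to be differentiable as a map into
    the larger space E0: since the derivative is continuous with values in E, its
    Riemann sums along a segment converge in E, and their limit is the increment
    because iota is injective ([primitive_in_subspace], [calG_frechet]). *)

Set Implicit Arguments.
Unset Strict Implicit.
Unset Printing Implicit Defensive.

Import Order.TTheory GRing.Theory Num.Theory.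
Import numFieldNormedType.Exports.

Local Open Scope classical_set_scope.
Local Open Scope ring_scope.

(** * The strong law of large numbers *)

Lemma bounded_integrable (R : realType) d (T : measurableType d)
    (mu : probability T R) (f : T -> R) M :
  measurable_fun [set: T] f -> (forall x, `|f x| <= M) ->
  mu.-integrable [set: T] (EFin \o f).
Proof.
move=> mf fM; apply: measurable_bounded_integrable => //.
  by rewrite [X in (X < _)%E]probability_setT ltry.
by exists M; split; [exact: num_real|] => y My x _; exact: le_trans (fM x) (ltW My).
Qed.

Lemma measurable_indicator_le (R : realType) d (T : measurableType d) (f : T -> R) t :
  measurable_fun [set: T] f ->
  measurable_fun [set: T] (fun x => (f x <= t)%R%:R : R).
Proof.
move=> mf; rewrite (_ : (fun x => _) = \1_[set x | f x <= t]); last first.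
  by apply/funext => x; rewrite indicE /= mem_setE.
apply: measurable_indic.
by rewrite -[X in measurable X]setTI; apply: (measurable_fun_ler mf).
Qed.

Lemma measurable_indicator_gt (R : realType) d (T : measurableType d) (f : T -> R) t :
  measurable_fun [set: T] f ->
  measurable_fun [set: T] (fun x => (t < f x)%R%:R : R).
Proof.
move=> mf; rewrite (_ : (fun x => _) = (fun x => 1 - (f x <= t)%R%:R)); last first.
  by apply/funext => x; rewrite ltNge; case: (f x <= t); rewrite ?subrr ?subr0.
by apply: measurable_funB => //; exact: measurable_indicator_le.
Qed.

Section independence.
Context (R : realType) (d d' : measure_display).
Context (Omega : measurableType d) (P : probability Omega R).
Context (T : measurableType d') (xs : nat -> {RV P >-> T}).
Hypothesis xs_indep : independent xs.

Lemma independent_pair i j (A B : set T) : i != j ->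
  measurable A -> measurable B ->
  P ((xs i @^-1` A) `&` (xs j @^-1` B))
  = (P (xs i @^-1` A) * P (xs j @^-1` B))%E.
Proof.
move=> ij mA mB.
have := xs_indep (s := [:: i; j]) (A := fun k => if k == i then A else B).
rewrite /= inE ij => /(_ isT) H.
have /H : forall k, measurable (if k == i then A else B) by move=> k; case: ifP.
by rewrite !big_cons !big_nil eqxx eq_sym (negbTE ij) setIT mule1.
Qed.

(** Independence says that the joint law of the pair agrees with the product law
    on rectangles, hence everywhere; the claim is then Fubini's theorem. *)
Lemma independent_expectationM (f g : T -> R) M i j : i != j ->
  measurable_fun [set: T] f -> measurable_fun [set: T] g ->
  (forall x, `|f x| <= M) -> (forall x, `|g x| <= M) ->
  \int[P]_w (f (xs i w) * g (xs j w)) =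
  (\int[P]_w f (xs i w)) * (\int[P]_w g (xs j w)).
Proof.
move=> ij mf mg fM gM.
pose Z w := (xs i w, xs j w).
have mZ : measurable_fun [set: Omega] Z by exact: measurable_fun_pair.
pose F (z : T * T) := f z.1 * g z.2.
have mF : measurable_fun [set: T * T] F.
  by apply: measurable_funM; exact: measurableT_comp.
have FM z : `|F z| <= M * M by rewrite normrM ler_pM.
pose Zm : {mfun Omega >-> (T * T)%type} := HB.pack Z (isMeasurableFun.Build _ _ _ _ _ mZ).
pose m1 := distribution P (xs i); pose m2 := distribution P (xs j).
have intF : (distribution P Zm).-integrable [set: T * T] (EFin \o F).
  exact: bounded_integrable mF FM.
have prodE A : measurable A -> (m1 \x m2)%E A = distribution P Zm A.
  by apply: product_measure_unique => A1 A2 mA mB; exact: independent_pair.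
have intF' : (m1 \x m2)%E.-integrable [set: T * T] (EFin \o F).
  apply: measurable_bounded_integrable => //.
    by rewrite [X in (X < _)%E]prodE// [X in (X < _)%E]probability_setT ltry.
  by exists (M * M); split; [exact: num_real|] => y My x _;
    exact: le_trans (FM x) (ltW My).
have mfj k (h : T -> R) : measurable_fun [set: T] h ->
    (forall x, `|h x| <= M) ->
    \int[P]_w h (xs k w) = \int[distribution P (xs k)]_x h x.
  move=> mh hM; rewrite /Rintegral integral_distribution//.
    exact/measurable_EFinP.
  apply: (@bounded_integrable _ _ _ _ (h \o xs k) M) => [|x]; last exact: hM.
  exact: (measurableT_comp mh).
rewrite !mfj// /Rintegral.
transitivity (fine (\int[distribution P Zm]_z (F z)%:E)).
  rewrite integral_distribution//; first exact/measurable_EFinP.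
  apply: (@bounded_integrable _ _ _ _ (F \o Z) (M * M)) => [|x]; last exact: FM.
  exact: (measurableT_comp mF mZ).
rewrite -(eq_measure_integral (distribution P Zm) (m1 := (m1 \x m2)%E)); last first.
  by move=> A mA _; exact: prodE.
rewrite -(integral12_prod_meas1 intF').
rewrite -[RHS]/(_ * \int[m2]_x g x) -RintegralZr//; last exact: bounded_integrable fM.
congr fine; apply: eq_integral => x _; rewrite /fubini_F /F /=.
under eq_integral do rewrite EFinM.
rewrite integralZl//; last exact: bounded_integrable gM.
by rewrite EFinM fineK//; apply: integrable_fin_num => //; exact: bounded_integrable gM.
Qed.

End independence.

Section truncated_sums.
Context (R : realType) (d d' : measure_display).
Context (Omega : measurableType d) (P : probability Omega R).
Context (T : measurableType d') (mu : probability T R).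
Context (xs : nat -> {RV P >-> T}).
Hypothesis xs_indep : independent xs.
Hypothesis xs_law : forall i (A : set T), measurable A ->
  distribution P (xs i) A = mu A.

Lemma integrable_sample i (h : T -> R) (M : R) : measurable_fun [set: T] h ->
  (forall x, `|h x| <= M) ->
  P.-integrable [set: Omega] (EFin \o (h \o xs i)).
Proof.
move=> mh hM.
apply: (@bounded_integrable _ _ _ _ (h \o xs i) M) => [|x]; last exact: hM.
exact: (measurableT_comp mh).
Qed.

Lemma integral_sample i (h : T -> R) (M : R) : measurable_fun [set: T] h ->
  (forall x, `|h x| <= M) ->
  \int[P]_w h (xs i w) = \int[mu]_x h x.
Proof.
move=> mh hM; rewrite /Rintegral.
rewrite -(eq_measure_integral mu (m1 := distribution P (xs i))); last first.
  by move=> A mA _; exact: xs_law.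
rewrite integral_distribution//; first exact/measurable_EFinP.
exact: integrable_sample hM.
Qed.

Definition sample_sum (g : T -> R) n w := \sum_(i < n) g (xs i w).

Lemma measurable_sample_sum g n : measurable_fun [set: T] g ->
  measurable_fun [set: Omega] (sample_sum g n).
Proof.
move=> mg; apply: measurable_sum => i; exact: (measurableT_comp mg).
Qed.

Lemma sample_sum_bounded (g : T -> R) (M : R) n w : (forall x, `|g x| <= M) ->
  `|sample_sum g n w| <= n%:R * M.
Proof.
move=> gM; rewrite /sample_sum; apply: le_trans (ler_norm_sum _ _ _) _.
apply: le_trans (_ : \sum_(i < n) M <= _); first exact: ler_sum.
by rewrite sumr_const card_ord mulr_natl.
Qed.

Lemma sample_sum_uncorrelated (g : T -> R) (M : R) m n : (m <= n)%N ->
  measurable_fun [set: T] g -> (forall x, `|g x| <= M) ->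
  \int[mu]_x g x = 0 ->
  \int[P]_w (sample_sum g m w * g (xs n w)) = 0.
Proof.
move=> mn mg gM g0; elim: m mn => [|m IH] mn.
  under eq_Rintegral do rewrite /sample_sum big_ord0 mul0r.
  by rewrite Rintegral_cst// mul0r.
under eq_Rintegral do rewrite /sample_sum big_ord_recr /= mulrDl.
have mg' i : measurable_fun [set: Omega] (g \o xs i).
  exact: (measurableT_comp mg).
rewrite RintegralD//.
- rewrite [X in X + _]IH; last exact: ltnW.
  rewrite add0r (independent_expectationM xs_indep _ mg mg gM gM); last first.
    by rewrite neq_ltn mn.
  by rewrite (integral_sample _ mg gM) g0 mul0r.
- apply: (@bounded_integrable _ _ _ _ _ ((m%:R * M) * M)) => [|w].
    by apply: measurable_funM; [exact: measurable_sample_sum|exact: mg'].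
  by rewrite normrM ler_pM//; exact: sample_sum_bounded.
- apply: (@bounded_integrable _ _ _ _ _ (M * M)) => [|w].
    by apply: measurable_funM; exact: mg'.
  by rewrite normrM ler_pM.
Qed.

(** The cross terms of the square vanish: centred independent variables are
    uncorrelated. *)
Lemma sample_sum_second_moment (g : T -> R) (M : R) n :
  measurable_fun [set: T] g -> (forall x, `|g x| <= M) ->
  \int[mu]_x g x = 0 ->
  \int[P]_w (sample_sum g n w ^+ 2) = n%:R * \int[mu]_x (g x ^+ 2).
Proof.
move=> mg gM g0.
have M0 : 0 <= M by exact: le_trans (gM point).
elim: n => [|n IH].
  under eq_Rintegral do rewrite /sample_sum big_ord0 expr0n /=.
  by rewrite Rintegral_cst// !mul0r.
have mg' i : measurable_fun [set: Omega] (g \o xs i).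
  exact: (measurableT_comp mg).
have mS := measurable_sample_sum n mg.
have SM w := sample_sum_bounded n w gM.
under eq_Rintegral => w _.
  rewrite /sample_sum big_ord_recr /= -/(sample_sum g n w).
  rewrite (_ : _ ^+ 2 = sample_sum g n w ^+ 2 +
    (2 * (sample_sum g n w * g (xs n w)) + g (xs n w) ^+ 2)); last by ring.
  over.
have iS2 : P.-integrable [set: Omega] (EFin \o (fun w => sample_sum g n w ^+ 2)).
  apply: (@bounded_integrable _ _ _ _ _ ((n%:R * M) ^+ 2)) => [|w].
    exact: measurable_funX.
  by rewrite normrX ler_sqr ?nnegrE// mulr_ge0.
have iSg : P.-integrable [set: Omega]
    (EFin \o (fun w => sample_sum g n w * g (xs n w))).
  apply: (@bounded_integrable _ _ _ _ _ (n%:R * M * M)) => [|w].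
    by apply: measurable_funM => //; exact: mg'.
  by rewrite normrM ler_pM.
have ig2 : P.-integrable [set: Omega] (EFin \o (fun w => g (xs n w) ^+ 2)).
  apply: (@bounded_integrable _ _ _ _ _ (M ^+ 2)) => [|w].
    exact: (measurable_funX _ (mg' n)).
  by rewrite normrX ler_sqr ?nnegrE.
have iSg2 : P.-integrable [set: Omega]
    (EFin \o (fun w => 2 * (sample_sum g n w * g (xs n w)))).
  by under [X in integrable _ _ X]eq_fun do rewrite /= EFinM; exact: integrableZl.
rewrite RintegralD//; last first.
  by under [X in integrable _ _ X]eq_fun do rewrite /= EFinD; exact: integrableD.
rewrite RintegralD// RintegralZl// IH.
rewrite (sample_sum_uncorrelated (leqnn n) mg gM g0) mulr0 add0r.
have -> : \int[P]_w g (xs n w) ^+ 2 = \int[mu]_x g x ^+ 2.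
  apply: (@integral_sample _ (fun x => g x ^+ 2) (M ^+ 2)) => [|x].
    exact: measurable_funX.
  by rewrite normrX ler_sqr ?nnegrE.
by rewrite -natr1; ring.
Qed.


Lemma sample_sum_chebyshev (g : T -> R) (M : R) n (c : R) : 0 < c ->
  measurable_fun [set: T] g -> (forall x, `|g x| <= M) ->
  \int[mu]_x g x = 0 ->
  (P [set w | (c <= `|sample_sum g n w|)%R]
    <= (n%:R * \int[mu]_x (g x ^+ 2) / c ^+ 2)%:E)%E.
Proof.
move=> c0 mg gM g0.
have mS := measurable_sample_sum n mg.
have M0 : 0 <= M by exact: le_trans (gM point).
pose S : {RV P >-> R} := HB.pack (sample_sum g n) (isMeasurableFun.Build _ _ _ _ _ mS).
have := @markov _ _ _ P S (fun x => x ^+ 2) c c0.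
move=> /(_ (measurable_funX _ (@measurable_id _ _ _)))/(_ (fun r _ => sqr_ge0 r)).
have h : {in Num.nneg &, {homo (fun x : R => x ^+ 2) : x y / x <= y}}.
  by move=> x y; rewrite !nnegrE => x0 y0 xy; rewrite ler_sqr ?nnegrE.
move=> /(_ h).
rewrite unlock (_ : [set x | _] = [set w | c <= `|sample_sum g n w|]) //.
have -> : (\int[P]_w (((fun x => x ^+ 2) \o Num.norm) (S w))%:E)%E =
    (n%:R * \int[mu]_x (g x ^+ 2))%:E.
  rewrite -(sample_sum_second_moment _ mg gM g0) fineK.
    by apply: eq_integral => w _ /=; rewrite real_normK ?num_real.
  apply: integrable_fin_num => //.
  apply: (@bounded_integrable _ _ _ _ _ ((n%:R * M) ^+ 2)) => [|w].
    exact: measurable_funX.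
  by rewrite normrX ler_sqr ?nnegrE ?mulr_ge0//; exact: sample_sum_bounded.
by rewrite muleC -lee_pdivlMr ?exprn_gt0// -EFinM.
Qed.

(** Truncating f at the level t costs at most the probability that one of the k
    terms exceeds t, and Chebyshev's inequality handles the truncated sum. Since
    k and t are comparable, both costs are integrals over a single variable of
    quantities that do not involve k. *)
Lemma truncation_deviation (f : T -> R) (t e : R) (k : nat) :
  measurable_fun [set: T] f -> (forall x, 0 <= f x) -> 0 < t -> 0 < e ->
  t <= k%:R -> k%:R <= 2 * t ->
  (P [set w | (e * k%:R <=
       `|sample_sum f k w - k%:R * \int[mu]_x (f x * (f x <= t)%R%:R)|)%R]
   <= \int[mu]_x (2 * t * (t < f x)%R%:R +
                  e ^- 2 * (f x ^+ 2 / t * (f x <= t)%R%:R))%:E)%E.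
Proof.
move=> mf f0 t0 e0 tk k2t.
have k0 : 0 < k%:R :> R by exact: lt_le_trans tk.
pose ft x := f x * (f x <= t)%R%:R.
pose m := \int[mu]_x ft x.
pose g x := ft x - m.
have mle := measurable_indicator_le t mf.
have mgt := measurable_indicator_gt t mf.
have mft : measurable_fun [set: T] ft by exact: measurable_funM.
have ft0 x : 0 <= ft x by rewrite mulr_ge0.
have ftt x : ft x <= t.
  by rewrite /ft; case: (leP (f x) t); rewrite ?mulr1// mulr0 ltW.
have m0 : 0 <= m by exact: Rintegral_ge0.
have ift : mu.-integrable [set: T] (EFin \o ft).
  by apply: (@bounded_integrable _ _ _ _ _ t) => // x; rewrite ger0_norm.
have cstI (c : R) : mu.-integrable [set: T] (EFin \o (fun=> c)).
  by apply: (@bounded_integrable _ _ _ _ _ `|c|).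
have mt : m <= t.
  apply: le_trans (_ : \int[mu]_x t <= _).
    by apply: le_Rintegral => //; exact: cstI.
  by rewrite Rintegral_cst// [X in fine X]probability_setT mulr1.
have mg : measurable_fun [set: T] g by exact: measurable_funB.
have gt x : `|g x| <= t.
  by rewrite /g ler_norml; have := ft0 x; have := ftt x; lra.
have ig : mu.-integrable [set: T] (EFin \o g) by exact: bounded_integrable gt.
have g0 : \int[mu]_x g x = 0.
  rewrite RintegralB//.
  by rewrite Rintegral_cst// [X in fine X]probability_setT mulr1 subrr.
have ift2 : mu.-integrable [set: T] (EFin \o (fun x => ft x ^+ 2)).
  apply: (@bounded_integrable _ _ _ _ _ (t ^+ 2)) => [|x]; first exact: measurable_funX.
  by rewrite normrX ler_sqr ?nnegrE ?(ltW t0)// ger0_norm.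
have g2 : \int[mu]_x (g x ^+ 2) <= \int[mu]_x (ft x ^+ 2).
  have -> : \int[mu]_x (g x ^+ 2) = \int[mu]_x (ft x ^+ 2) - m ^+ 2.
    transitivity (\int[mu]_x (ft x ^+ 2 - (2 * m * ft x - m ^+ 2))).
      by apply: eq_Rintegral => x _; rewrite /g; ring.
    have i2 : mu.-integrable [set: T] (EFin \o (fun x => 2 * m * ft x)).
      by under [X in integrable _ _ X]eq_fun do rewrite /= EFinM; exact: integrableZl.
    have i3 : mu.-integrable [set: T] (EFin \o (fun x => 2 * m * ft x - m ^+ 2)).
      by under [X in integrable _ _ X]eq_fun do rewrite /= EFinB; apply: integrableB => //; exact: cstI.
    rewrite RintegralB// RintegralB// RintegralZl// -/m.
    by rewrite Rintegral_cst// [X in fine X]probability_setT mulr1; ring.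
  by have := sqr_ge0 m; lra.
pose A i := [set w | t < f (xs i w)].
have mA i : measurable (A i).
  by rewrite -[X in measurable X]setTI; apply: (measurable_fun_ltr (measurable_cst _)) => //;
     exact: (measurableT_comp mf).
pose D := [set w | (e * k%:R <= `|sample_sum g k w|)%R].
have mD : measurable D.
  rewrite -[X in measurable X]setTI; apply: measurable_fun_ler => //.
  by apply: measurableT_comp => //; exact: measurable_sample_sum.
set E := [set w | _].
have ED : E `<=` D `|` \big[setU/set0]_(i < k) A i.
  move=> w Ew; have [[i Aiw]|nA] := pselect (exists i : 'I_k, A i w).
    by right; rewrite -bigcup_mkord; exists i => //=.
  left; rewrite /D /=; move: Ew; rewrite /E /= -/m.
  suff -> : sample_sum g k w = sample_sum f k w - k%:R * m by [].
  rewrite /sample_sum /g sumrB sumr_const card_ord mulr_natl; congr (_ - _).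
  apply: eq_bigr => i _; rewrite /ft; case: leP => [_|tf]; first by rewrite mulr1.
  by exfalso; apply: nA; exists i.
have mE : measurable E.
  rewrite -[X in measurable X]setTI; apply: measurable_fun_ler => //.
  by apply: measurableT_comp => //; apply: measurable_funB => //; exact: measurable_sample_sum.
have mU : measurable (\big[setU/set0]_(i < k) A i) by exact: bigsetU_measurable.
apply: (@le_trans _ _ (P D + P (\big[setU/set0]_(i < k) A i))%E).
  apply: le_trans (measureU2 P mD mU).
  by apply: le_measure => //; rewrite inE//; exact: measurableU.
under eq_integral do rewrite EFinD.
rewrite ge0_integralD//=; last 4 first.
- by move=> x _; rewrite lee_fin mulr_ge0// mulr_ge0// ltW.
- by apply/measurable_EFinP; apply: measurable_funM.
- by move=> x _; rewrite lee_fin !mulr_ge0// ?invr_ge0 ?sqr_ge0// ltW.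
- apply/measurable_EFinP; apply: measurable_funM => //; apply: measurable_funM => //.
  by apply: measurable_funM => //; exact: measurable_funX.
rewrite addeC; apply: leeD.
  apply: le_trans (Boole_inequality P (fun i _ => mA i)) _.
  have PA i : (P (A i) <= \int[mu]_x (t < f x)%R%:R%:E)%E.
    rewrite le_eqVlt; apply/orP; left; apply/eqP; transitivity (mu [set x | t < f x]).
      rewrite -(xs_law i)//; rewrite -[X in measurable X]setTI.
      exact: (measurable_fun_ltr (measurable_cst _) mf).
    rewrite -[in LHS](setIT [set x | t < f x]) -integral_indic//; last first.
      rewrite -[X in measurable X]setTI.
      exact: (measurable_fun_ltr (measurable_cst _) mf).
    by apply: eq_integral => x _; rewrite indicE /= mem_setE.
  apply: (@le_trans _ _ (\sum_(i < k) (\int[mu]_x (t < f x)%R%:R%:E))%E).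
    by apply: lee_sum => i _; exact: PA.
  under [leRHS]eq_integral do rewrite EFinM.
  rewrite ge0_integralZl_EFin//; last 2 first.
  - exact/measurable_EFinP.
  - by rewrite mulr_ge0// ltW.
  set I := (\int[mu]_x _)%E.
  have I0 : (0 <= I)%E by apply: integral_ge0 => x _; rewrite lee_fin.
  rewrite (_ : (\sum_(i < k) I)%E = k%:R%:E * I)%E; last first.
    by rewrite sumr_const card_ord mule_natl.
  by apply: lee_wpmul2r => //; rewrite lee_fin.
under eq_integral do rewrite EFinM.
have mf2 : measurable_fun [set: T] (fun x => f x ^+ 2 / t * (f x <= t)%R%:R).
  apply: measurable_funM => //; apply: measurable_funM => //.
  exact: measurable_funX.
have f2t x : f x ^+ 2 / t * (f x <= t)%R%:R = ft x ^+ 2 * t^-1.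
  by rewrite /ft exprMn; case: (f x <= t); rewrite ?mulr1 ?expr1n ?mulr1// expr0n !mulr0 mul0r.
rewrite ge0_integralZl_EFin//; last 3 first.
- by move=> x _; rewrite lee_fin f2t mulr_ge0 ?sqr_ge0// invr_ge0 ltW.
- exact/measurable_EFinP.
- by rewrite invr_ge0 sqr_ge0.
apply: le_trans (sample_sum_chebyshev k (mulr_gt0 e0 k0) mg gt g0) _.
under eq_integral do rewrite f2t EFinM muleC.
rewrite ge0_integralZl_EFin//; last 3 first.
- by move=> x _; rewrite lee_fin sqr_ge0.
- by apply/measurable_EFinP; exact: measurable_funX.
- by rewrite invr_ge0 ltW.
have fin2 : (\int[mu]_x (ft x ^+ 2)%:E \is a fin_num)%E.
  exact: integrable_fin_num ift2.
rewrite -(fineK fin2) -!EFinM lee_fin -/(\int[mu]_x (ft x ^+ 2)).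
set q := \int[mu]_x (ft x ^+ 2) in g2 *.
rewrite (_ : k%:R * _ / _ = e ^- 2 * (k%:R^-1 * \int[mu]_x g x ^+ 2)); last first.
  by field; rewrite (gt_eqF k0) (gt_eqF e0).
rewrite ler_wpM2l ?invr_ge0 ?sqr_ge0//.
have q0 : 0 <= \int[mu]_x (g x ^+ 2) by apply: Rintegral_ge0 => x _; exact: sqr_ge0.
apply: ler_pM => //.
by rewrite lef_pV2.
Qed.
End truncated_sums.

(** A geometric sum is at most a constant times its last term, here below x. The
    induction carries the second bound, in terms of n, along. *)
Lemma geometric_below_sum (R : realType) (a x : R) n : 1 < a -> 0 <= x ->
  \sum_(i < n) (a ^+ i * (a ^+ i < x)%R%:R) <= a / (a - 1) * x.
Proof.
move=> a1 x0; have a0 : 0 < a by lra.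
have a10 : 0 < a - 1 by lra.
suff [H _] : \sum_(i < n) (a ^+ i * (a ^+ i < x)%R%:R) <= a / (a - 1) * x /\
    \sum_(i < n) (a ^+ i * (a ^+ i < x)%R%:R) <= a ^+ n / (a - 1) by [].
elim: n => [|n [IH1 IH2]].
  by rewrite big_ord0 expr0; split; rewrite !mulr_ge0 ?invr_ge0 ?(ltW a0) ?(ltW a10).
rewrite big_ord_recr /= exprS.
have an0 : 0 < a ^+ n by exact: exprn_gt0.
set s := \sum_(i < n) _ in IH1 IH2 *.
have e : a * a ^+ n / (a - 1) = a ^+ n / (a - 1) + a ^+ n by field; lra.
case: (ltP (a ^+ n) x) => [lx|xl]; last first.
  rewrite mulr0 addr0; split=> //; rewrite e; lra.
rewrite mulr1 e; split; last lra.
have : a ^+ n * (a / (a - 1)) <= x * (a / (a - 1)).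
  by apply: ler_wpM2r; [rewrite mulr_ge0 ?invr_ge0 ?(ltW a0) ?(ltW a10)|exact: ltW].
rewrite (_ : a ^+ n * (a / (a - 1)) = a ^+ n / (a - 1) + a ^+ n); last by field; lra.
rewrite (mulrC x); lra.
Qed.

(** The sum starts at the first power above x, where the term is at most x, and
    decays geometrically. The induction works with a bound that already
    subtracts the tail still to come. *)
Lemma geometric_above_sum (R : realType) (a x : R) n : 1 < a -> 0 <= x ->
  \sum_(i < n) (x ^+ 2 / a ^+ i * (x <= a ^+ i)%R%:R) <= a / (a - 1) * x.
Proof.
move=> a1 x0; have a0 : 0 < a by lra.
have a10 : 0 < a - 1 by lra.
have c0 : 0 < a / (a - 1) by rewrite divr_gt0.
have [->|xn0] := eqVneq x 0.
  by rewrite mulr0 big1// => i _; rewrite expr0n /= !mul0r.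
have {xn0 x0}x0 : 0 < x by rewrite lt_neqAle eq_sym xn0.
suff H : \sum_(i < n) (x ^+ 2 / a ^+ i * (x <= a ^+ i)%R%:R) <=
    a / (a - 1) * (x - x ^+ 2 / Num.max x (a ^+ n)).
  apply: le_trans H _; rewrite ler_pM2l// lerBlDr lerDl.
  by rewrite divr_ge0 ?sqr_ge0// le_max (ltW x0).
elim: n => [|n IH].
  rewrite big_ord0; apply: mulr_ge0; first exact: ltW.
  rewrite subr_ge0 ler_pdivrMr; last by rewrite lt_max x0.
  by rewrite expr2 ler_pM2l// le_max lexx.
rewrite big_ord_recr /=.
have an0 : 0 < a ^+ n by exact: exprn_gt0.
have anS : a ^+ n <= a ^+ n.+1 by rewrite exprS ler_peMl// ltW.
case: (leP x (a ^+ n)) => [xl|lx]; last first.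
  rewrite mulr0 addr0; apply: le_trans IH _.
  rewrite ler_pM2l// lerD2l lerN2 ler_pM2l ?exprn_gt0//.
  rewrite lef_pV2 ?posrE ?lt_max ?x0//.
  by rewrite ge_max le_max lexx /= le_max anS orbT.
rewrite mulr1.
move: IH; rewrite !max_r//; last exact: le_trans anS.
set s := \sum_(i < n) _ => IH.
rewrite [a ^+ n.+1]exprS.
have -> : a / (a - 1) * (x - x ^+ 2 / (a * a ^+ n)) =
   a / (a - 1) * (x - x ^+ 2 / a ^+ n) + x ^+ 2 / a ^+ n.
  by field; rewrite !gt_eqF// ltW.
lra.
Qed.

(** The sample sizes along which convergence is first proved; comparable to a ^+ n
    and positive. *)
Definition geom_index (R : realType) (a : R) (n : nat) := (Num.truncn (a ^+ n)).+1.

Lemma geom_index_gt (R : realType) (a : R) n : a ^+ n < (geom_index a n)%:R.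
Proof. exact: truncnS_gt. Qed.

Lemma geom_index_le (R : realType) (a : R) n : 0 <= a ->
  (geom_index a n)%:R <= a ^+ n + 1.
Proof.
move=> a0; have /andP[+ _] := truncn_itv (exprn_ge0 n a0).
by rewrite /geom_index -natr1 lerD2r.
Qed.

Lemma cvg_expr_pinfty (R : realType) (a : R) : 1 < a ->
  a ^+ n @[n --> \oo] --> +oo.
Proof.
move=> a1; apply/cvgryPge => M.
have a10 : 0 < a - 1 by lra.
near=> n.
have H : 1 + n%:R * (a - 1) <= a ^+ n.
  elim: (n) => [|k IH]; first by rewrite mul0r addr0 expr0.
  rewrite exprS -natr1.
  have : a * (1 + k%:R * (a - 1)) <= a * a ^+ k by rewrite ler_pM2l//; lra.
  apply: le_trans; rewrite -subr_ge0.
  rewrite (_ : _ - _ = k%:R * (a - 1) ^+ 2); last by ring.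
  by rewrite mulr_ge0// sqr_ge0.
apply: le_trans H.
have : M / (a - 1) <= n%:R by near: n; exact: nbhs_infty_ger.
by rewrite ler_pdivrMr//; lra.
Unshelve. all: by end_near. Qed.

Lemma leq_geom_index (R : realType) (a : R) : 1 < a ->
  {homo geom_index a : m n / (m <= n)%N}.
Proof.
move=> a1 m n mn; rewrite /geom_index ltnS; apply: le_truncn.
by rewrite ler_weXn2l// ltW.
Qed.

(** A monotone sequence between two consecutive sample sizes, whose ratio is close
    to a, is off by a factor close to a. One parameter j controls both the ratio
    and the error, so countably many almost sure events suffice. *)
Lemma geometric_interpolation (R : realType) (s : nat -> R) (m : R) :
  0 <= m -> (forall n, 0 <= s n) -> {homo s : p q / (p <= q)%N >-> p <= q} ->
  (forall j, let e := j.+1%:R^-1 in let a := 1 + e in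
     \forall n \near \oo, `|s (geom_index a n) - (geom_index a n)%:R * m|
                          <= 2 * e * (geom_index a n)%:R) ->
  n%:R^-1 * s n @[n --> \oo] --> m.
Proof.
move=> m0 s0 s_nd H; apply/cvgrPdist_le => eps eps0.
(* With ratio and error e <= 1, the quotient is within e * (8 + 3 * m) of m. *)
have M0 : 0 < eps / (8 + 3 * m) by rewrite divr_gt0//; lra.
have [j je] : exists j, j.+1%:R^-1 <= eps / (8 + 3 * m).
  exists (Num.truncn (eps / (8 + 3 * m))^-1).
  by rewrite invf_ple ?posrE// ltW// truncnS_gt.
move: (H j); rewrite /=; set e : R := j.+1%:R^-1 in je *; set a := 1 + e => Hj.
have e0 : 0 < e by rewrite invr_gt0.
have e1 : e <= 1 by rewrite invf_le1// ler1n.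
have a1 : 1 < a by rewrite /a; lra.
have {M0}je : e * (8 + 3 * m) <= eps by rewrite -ler_pdivlMr//; lra.
pose k := geom_index a.
have kS : \forall n \near \oo, (k n.+1)%:R <= (1 + 3 * e) * (k n)%:R.
  have /cvgryPge/(_ (a * e)^-1) := cvg_expr_pinfty a1.
  apply: filterS => n an.
  have a0 : 0 < a by lra.
  have l1 : 1 <= a * e * a ^+ n by rewrite -ler_pdivrMl ?mulr_gt0// mulr1.
  apply: le_trans (geom_index_le _ (ltW a0)) _.
  apply: le_trans (_ : a ^+ 2 * a ^+ n <= _).
    have -> : a ^+ 2 * a ^+ n = a * a ^+ n + a * e * a ^+ n by rewrite /a; ring.
    by rewrite exprS lerD2l.
  apply: ler_pM; rewrite ?sqr_ge0 ?exprn_ge0 ?(ltW a0)//.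
    rewrite /a; have : e * e <= e by rewrite ler_piMr// ltW.
    by nra.
  exact: ltW (geom_index_gt a n).
have [n1 _ Hn1] : \forall n \near \oo, `|s (k n) - (k n)%:R * m|
    <= 2 * e * (k n)%:R /\ (k n.+1)%:R <= (1 + 3 * e) * (k n)%:R.
  by apply: filterS2 Hj kS.
near=> N.
have kN : (k n1 <= N)%N by near: N; exact: nbhs_infty_ge.
have N0 : (0 < N)%N by exact: leq_trans kN.
have exk : exists n, (N < k n)%N.
  have /cvgryPge/(_ N%:R)[p _ /(_ p (leqnn p)) Np] := cvg_expr_pinfty a1.
  exists p; rewrite -(ltr_nat R); exact: le_lt_trans Np (geom_index_gt a p).
have [n [nn1 knN NkS]] : exists n, [/\ (n1 <= n)%N, (k n <= N)%N & (N < k n.+1)%N].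
  case: (ex_minnP exk) => -[|n] Nk nmin.
    have := leq_geom_index a1 (leq0n n1); rewrite leqNgt => /negP[].
    exact: leq_ltn_trans kN Nk.
  exists n; split=> //.
    rewrite leqNgt; apply/negP => nn1.
    have := leq_geom_index a1 nn1; rewrite leqNgt => /negP[].
    exact: leq_ltn_trans kN Nk.
  rewrite leqNgt; apply/negP => /nmin; by rewrite ltnn.
have [Hn Kn] := Hn1 n nn1.
have [HnS _] := Hn1 n.+1 (leqW nn1).
have k0 : 0 < (k n)%:R :> R by rewrite ltr0n.
have knN' : (k n)%:R <= N%:R :> R by rewrite ler_nat.
have NkS' : N%:R <= (k n.+1)%:R :> R by rewrite ler_nat ltnW.
have s1 := s_nd _ _ knN; have s2 := s_nd _ _ (ltnW NkS).
have N0' : 0 < N%:R :> R by rewrite ltr0n.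
rewrite distrC -(ler_pM2l N0') -{1}(gtr0_norm N0') -normrM mulrBr mulrA mulfV ?gt_eqF// mul1r.
move: Hn HnS; rewrite !ler_norml => /andP[Hn _] /andP[_ HnS].
apply/andP; split; last first.
  have h1 : s N <= (m + 2 * e) * (k n.+1)%:R by lra.
  have h2 : (m + 2 * e) * (k n.+1)%:R <= (m + 2 * e) * ((1 + 3 * e) * (k n)%:R).
    by apply: ler_wpM2l => //; lra.
  have h3 : (m + 2 * e) * ((1 + 3 * e) * (k n)%:R) <= (m + 2 * e) * ((1 + 3 * e) * N%:R).
    by apply: ler_wpM2l; [lra|apply: ler_wpM2l => //; lra].
  have h4 : (m + 2 * e) * (1 + 3 * e) <= m + eps.
    have : e * e <= e by rewrite ler_piMr// ltW.
    by nra.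
  have h5 : ((m + 2 * e) * (1 + 3 * e)) * N%:R <= (m + eps) * N%:R.
    by rewrite ler_pM2r.
  by lra.
have [me|me] := leP m eps.
  have := s0 N; have : m * N%:R <= eps * N%:R by rewrite ler_pM2r.
  by lra.
have h1 : (m - 2 * e) * (k n)%:R <= s N by lra.
have h2 : (m - eps) * N%:R <= (m - eps) * ((1 + 3 * e) * (k n)%:R).
  by apply: ler_wpM2l; [lra|exact: le_trans Kn].
have h3 : (m - eps) * (1 + 3 * e) <= m - 2 * e by nra.
have h4 : (m - eps) * (1 + 3 * e) * (k n)%:R <= (m - 2 * e) * (k n)%:R.
  by rewrite ler_pM2r.
by lra.
Unshelve. all: by end_near. Qed.

Section strong_law.
Context (R : realType) (d d' : measure_display).
Context (Omega : measurableType d) (P : probability Omega R).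
Context (T : measurableType d') (mu : probability T R).
Context (xs : nat -> {RV P >-> T}).
Hypothesis xs_indep : independent xs.
Hypothesis xs_law : forall i (A : set T), measurable A ->
  distribution P (xs i) A = mu A.

Lemma cvg_truncated_mean (f : T -> R) (a : R) : 1 < a ->
  measurable_fun [set: T] f -> (forall x, 0 <= f x) ->
  mu.-integrable [set: T] (EFin \o f) ->
  \int[mu]_x (f x * (f x <= a ^+ n)%R%:R) @[n --> \oo] --> \int[mu]_x f x.
Proof.
move=> a1 mf f0 intf.
have mle n : measurable_fun [set: T] (fun x => (f x * (f x <= a ^+ n)%R%:R)).
  by apply: measurable_funM => //; exact: measurable_indicator_le.
have := @dominated_convergence _ _ _ mu setT measurableT
  (fun n x => (f x * (f x <= a ^+ n)%R%:R)%:E) (EFin \o f) (EFin \o f).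
move=> /(_ (fun n => (measurable_EFinP _ _).2 (mle n)) ((measurable_EFinP _ _).2 mf)).
case=> //.
- apply: aeW => x _ /=; apply/fine_cvgP; split; first exact: nearW.
  apply: cvg_near_cst.
  have /cvgryPge/(_ (f x)) := cvg_expr_pinfty a1.
  by apply: filterS => n /= ->; rewrite mulr1.
- apply: aeW => x n _ /=; rewrite lee_fin normrM ger0_norm//.
  by case: (f x <= _); rewrite ?normr1 ?mulr1// normr0 mulr0.
move=> _ _ H; apply: fine_cvg; rewrite /= fineK//.
exact: integrable_fin_num.
Qed.

(** Borel-Cantelli: the deviation probabilities are bounded by integrals whose sum
    over n is, pointwise in x, at most a constant times f x by the two geometric
    sums, and f is integrable. *)
Lemma strong_law_geometric (f : T -> R) (a e : R) : 1 < a -> 0 < e ->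
  measurable_fun [set: T] f -> (forall x, 0 <= f x) ->
  mu.-integrable [set: T] (EFin \o f) ->
  {ae P, forall w, \forall n \near \oo,
    `|sample_sum xs f (geom_index a n) w - (geom_index a n)%:R * \int[mu]_x f x|
    <= 2 * e * (geom_index a n)%:R}.
Proof.
move=> a1 e0 mf f0 intf.
have a0 : 0 < a by exact: lt_trans a1.
pose m n := \int[mu]_x (f x * (f x <= a ^+ n)%R%:R).
pose k := geom_index a.
pose A n := [set w | e * (k n)%:R <= `|sample_sum xs f (k n) w - (k n)%:R * m n|].
(* The bound of [truncation_deviation] at the level t = a ^+ n. *)
pose h n x := 2 * a ^+ n * (a ^+ n < f x)%R%:R +
                  e ^- 2 * (f x ^+ 2 / a ^+ n * (f x <= a ^+ n)%R%:R).
have mA n : measurable (A n).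
  rewrite -[X in measurable X]setTI; apply: measurable_fun_ler => //.
  by apply: measurableT_comp => //; apply: measurable_funB => //; exact: measurable_sample_sum.
have PA n : (P (A n) <= \int[mu]_x (h n x)%:E)%E.
  apply: truncation_deviation => //; first exact: exprn_gt0.
    exact: ltW (geom_index_gt a n).
  apply: le_trans (geom_index_le _ (ltW a0)) _.
  have : 1 <= a ^+ n by rewrite exprn_ege1// ltW.
  by lra.
have h0 n x : 0 <= h n x.
  by rewrite addr_ge0// !mulr_ge0// ?invr_ge0 ?sqr_ge0 ?exprn_ge0 ?(ltW a0).
have mle n := measurable_indicator_le (a ^+ n) mf.
have mlt n := measurable_indicator_gt (a ^+ n) mf.
have mh n : measurable_fun [set: T] (h n).
  apply: measurable_funD; first exact: measurable_funM.
  apply: measurable_funM => //; apply: measurable_funM => //.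
  by apply: measurable_funM => //; exact: measurable_funX.
pose C := 2 * (a / (a - 1)) + e ^- 2 * (a / (a - 1)).
have hC n x : \sum_(i < n) h i x <= C * f x.
  rewrite big_split /= /C mulrDl -!mulrA.
  apply: lerD.
    under eq_bigr do rewrite -mulrA.
    by rewrite -mulr_sumr ler_pM2l// mulrA; exact: geometric_below_sum.
  rewrite -mulr_sumr ler_wpM2l ?invr_ge0 ?sqr_ge0// mulrA.
  exact: geometric_above_sum.
have sumA : (\sum_(0 <= n <oo) P (A n) < +oo)%E.
  apply: (@le_lt_trans _ _ (\int[mu]_x (C * f x)%:E)%E); last first.
    have /integrableP[_] : mu.-integrable [set: T] (EFin \o (fun x => C * f x)).
      by under [X in integrable _ _ X]eq_fun do rewrite /= EFinM; exact: integrableZl.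
    apply: le_lt_trans; apply: ge0_le_integral => //.
    - move=> x _; rewrite lee_fin; apply: le_trans (hC 0%N x).
      by rewrite big_ord0.
    - by apply/measurable_EFinP; exact: measurable_funM.
    - apply: measurableT_comp => //; apply/measurable_EFinP.
      exact: measurable_funM.
    - by move=> x _; rewrite lee_fin ler_norm.
  apply: lime_le; first exact: is_cvg_nneseries.
  apply: nearW => n; rewrite big_mkord.
  apply: (@le_trans _ _ (\sum_(i < n) \int[mu]_x (h i x)%:E)%E).
    by apply: lee_sum => i _; exact: PA.
  rewrite -ge0_integral_sum//; last 2 first.
  - by move=> i; exact/measurable_EFinP.
  - by move=> i x _; rewrite lee_fin.
  apply: ge0_le_integral => //.
  - by move=> x _; apply: sume_ge0 => i _; rewrite lee_fin.
  - by apply: emeasurable_sum => i; exact/measurable_EFinP.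
  - by apply/measurable_EFinP; exact: measurable_funM.
  - by move=> x _; rewrite sumEFin lee_fin.
have A0 : P (lim_sup_set A) = 0%E by exact: lim_sup_set_cvg0.
have cm : \forall n \near \oo, `|m n - \int[mu]_x f x| <= e.
  have /cvgrPdist_le/(_ e e0) := cvg_truncated_mean a1 mf f0 intf.
  by apply: filterS => n; rewrite distrC.
exists (lim_sup_set A); split => //.
  apply: bigcap_measurable => // n _; exact: bigcup_measurable.
move=> w /= nH n _; apply: contrapT => nA; apply: nH.
near=> p.
have np : (n <= p)%N by near: p; exact: nbhs_infty_ge.
have /negP : ~ A p w by move=> Apw; apply: nA; exists p.
rewrite -ltNge => /ltW Hp.
have cmp : `|m p - \int[mu]_x f x| <= e by near: p.
rewrite (_ : _ - _ = sample_sum xs f (k p) w - (k p)%:R * m p +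
   (k p)%:R * (m p - \int[mu]_x f x)); last by rewrite /k; ring.
apply: le_trans (ler_normD _ _) _.
rewrite normrM ger0_norm//.
have : (k p)%:R * `|m p - \int[mu]_x f x| <= (k p)%:R * e by rewrite ler_wpM2l.
by rewrite -/(k p); lra.
Unshelve. all: by end_near. Qed.

Lemma strong_law_ge0 (f : T -> R) :
  measurable_fun [set: T] f -> (forall x, 0 <= f x) ->
  mu.-integrable [set: T] (EFin \o f) ->
  {ae P, forall w, n%:R^-1 * sample_sum xs f n w @[n --> \oo] --> \int[mu]_x f x}.
Proof.
move=> mf f0 intf.
have H j : {ae P, forall w, let e := j.+1%:R^-1 in let a := 1 + e in
    \forall n \near \oo,
    `|sample_sum xs f (geom_index a n) w - (geom_index a n)%:R * \int[mu]_x f x|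
    <= 2 * e * (geom_index a n)%:R}.
  by apply: strong_law_geometric => //; rewrite ?ltrDl invr_gt0.
have := ae_foralln H; apply: filterS => w Hw.
apply: geometric_interpolation => //.
- exact: Rintegral_ge0.
- by move=> n; apply: sumr_ge0.
- move=> p q pq; rewrite /sample_sum -!(big_mkord xpredT (fun i => f (xs i w))).
  by rewrite (big_cat_nat (leq0n p) pq) /= lerDl sumr_ge0.
Qed.

(** The nonnegative case applied to f + g and to g. *)
Lemma strong_law (f g : T -> R) :
  measurable_fun [set: T] f -> measurable_fun [set: T] g ->
  (forall x, `|f x| <= g x) ->
  mu.-integrable [set: T] (EFin \o g) ->
  {ae P, forall w, n%:R^-1 * sample_sum xs f n w @[n --> \oo] --> \int[mu]_x f x}.
Proof.
move=> mf mg fg intg.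
have intf : mu.-integrable [set: T] (EFin \o f).
  apply: le_integrable intg => //; first exact/measurable_EFinP.
  by move=> x _; rewrite /= lee_fin (le_trans (fg x))// ler_norm.
have g0 x : 0 <= g x by exact: le_trans (fg x).
have mfg : measurable_fun [set: T] (fun x => f x + g x) by exact: measurable_funD.
have intfg : mu.-integrable [set: T] (EFin \o (fun x => f x + g x)).
  by under [X in integrable _ _ X]eq_fun do rewrite /= EFinD; exact: integrableD.
have fg0 x : 0 <= f x + g x by have := fg x; rewrite ler_norml => /andP[]; lra.
apply: filterS2 (strong_law_ge0 mfg fg0 intfg) (strong_law_ge0 mg g0 intg) => w H1 H2.
have -> : \int[mu]_x f x = \int[mu]_x (f x + g x) - \int[mu]_x g x.
  by rewrite RintegralD// addrK.
under eq_cvg => n.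
  rewrite (_ : _ * _ = n%:R^-1 * sample_sum xs (fun x => f x + g x) n w
    - n%:R^-1 * sample_sum xs g n w); last first.
    by rewrite /sample_sum big_split /= -mulrBr addrK.
  over.
exact: cvgB.
Qed.

End strong_law.

(** * Primitives of continuous functions along an injection of Banach spaces *)

Section bisection.
Context (R : realType).

(** Otherwise halving would produce nested intervals without the property,
    shrinking to a point c around which the property holds by assumption. *)
Lemma bisection_principle (Q : R -> R -> Prop) :
  (forall a b, a <= b -> Q a ((a + b) / 2) -> Q ((a + b) / 2) b -> Q a b) ->
  (forall c, 0 <= c <= 1 -> exists2 e, 0 < e &
     forall a b, 0 <= a -> b <= 1 -> a <= c <= b -> b - a < e -> Q a b) ->
  Q 0 1.
Proof.
move=> Qmid Qloc; apply: contrapT => nQ.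
pose mid (p : R * R) := (p.1 + p.2) / 2.
pose step p := if `[< Q p.1 (mid p) >] then (mid p, p.2) else (p.1, mid p).
pose I n := iter n step (0, 1).
have IP n : [/\ ~ Q (I n).1 (I n).2, 0 <= (I n).1, (I n).2 <= 1 &
    (I n).2 - (I n).1 = 2^-1 ^+ n].
  elim: n => [|n [nQn I0 I1 In]]; first by rewrite /I /= expr0 subr0.
  have w0 : 0 < 2^-1 ^+ n :> R by rewrite exprn_gt0.
  rewrite /I iterS -/(I n) /step; case: asboolP => /= HQ.
    split=> //; last 2 first.
    - by rewrite /mid; lra.
    - by rewrite exprS /mid; lra.
    by move=> Q2; apply: nQn; apply: Qmid => //; lra.
  by split => //; rewrite ?exprS /mid; lra.
have lenI n : (I n).1 <= (I n).2.
  have [_ _ _ e] := IP n.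
  have : 0 < 2^-1 ^+ n :> R by rewrite exprn_gt0.
  by lra.
have stepI n : (I n).1 <= (I n.+1).1 /\ (I n.+1).2 <= (I n).2.
  have := lenI n; rewrite {2 3}/I /= -/(I n) /step.
  by case: ifP => _ /= ; rewrite /mid; split; lra.
have monI m n : (m <= n)%N -> (I m).1 <= (I n).1 /\ (I n).2 <= (I m).2.
  move=> /subnK <-; elim: (n - m)%N => [//|k [IH1 IH2]].
  have [s1 s2] := stepI (k + m)%N; rewrite addSn.
  by split; [exact: le_trans s1|exact: le_trans IH2].
have crossI m n : (I m).1 <= (I n).2.
  have [m1 m2] := monI _ _ (leq_maxl m n); have [n1 n2] := monI _ _ (leq_maxr m n).
  by have := lenI (maxn m n); lra.
pose c := sup (range (fun n => (I n).1)).
have ub n : ubound (range (fun n => (I n).1)) (I n).2 by move=> _ [m _ <-].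
have cI n : (I n).1 <= c <= (I n).2.
  apply/andP; split.
    by apply: ub_le_sup; [exists (I 0%N).2; exact: ub|exists n].
  by apply: ge_sup => //; exists (I 0%N).1; exists 0%N.
have c01 : 0 <= c <= 1 by exact: (cI 0%N).
have [e e0 He] := Qloc c c01.
have [n ne] : exists n, 2^-1 ^+ n < e.
  have /cvgrPdist_lt/(_ e e0)[n _ /(_ n (leqnn n))] : (2^-1 ^+ n : R) @[n --> \oo] --> 0.
    by apply: cvg_expr; rewrite ger0_norm ?invr_ge0// invf_lt1// ltr1n.
  by rewrite sub0r normrN ger0_norm ?exprn_ge0 ?invr_ge0//; exists n.
have [nQn I0 I1 In] := IP n.
by apply: nQn; apply: He => //; rewrite In.
Qed.

Context (E : normedModType R).

(** Riemann sums over dyadic partitions, tagged at left endpoints. The recursive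
    form makes them additive at midpoints, as the bisection principle requires. *)
Fixpoint bisect_sum (g : R -> E) n a b : E :=
  if n is n'.+1 then bisect_sum g n' a ((a + b) / 2) + bisect_sum g n' ((a + b) / 2) b
  else (b - a) *: g a.

Lemma bisect_sum_approx g n (a b eps : R) (v : E) : a <= b ->
  (forall t, a <= t <= b -> `|g t - v| <= eps) ->
  `|bisect_sum g n a b - (b - a) *: v| <= (b - a) * eps.
Proof.
elim: n a b => [|n IH] a b ab gv /=.
  rewrite -scalerBr normrZ ger0_norm ?subr_ge0// ler_wpM2l ?subr_ge0//.
  by apply: gv; rewrite lexx.
set m := (a + b) / 2.
have am : a <= m by rewrite /m; lra.
have mb : m <= b by rewrite /m; lra.
rewrite (_ : _ - _ = (bisect_sum g n a m - (m - a) *: v) +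
  (bisect_sum g n m b - (b - m) *: v)); last first.
  by rewrite addrACA -opprD -scalerDl; congr (_ - _ *: _); ring.
apply: le_trans (ler_normD _ _) _.
have h1 := IH a m am; have h2 := IH m b mb.
have {}h1 : `|bisect_sum g n a m - (m - a) *: v| <= (m - a) * eps.
  by apply: h1 => t /andP[at_ tm]; apply: gv; rewrite at_ (le_trans tm).
have {}h2 : `|bisect_sum g n m b - (b - m) *: v| <= (b - m) * eps.
  by apply: h2 => t /andP[mt tb]; apply: gv; rewrite tb (le_trans am).
by lra.
Qed.

Definition continuous01 (g : R -> E) := forall c, 0 <= c <= 1 ->
  forall eps, 0 < eps -> exists2 e, 0 < e &
  forall t, 0 <= t <= 1 -> `|t - c| < e -> `|g t - g c| <= eps.

(** The property that the sums over [a, b] are Cauchy up to (b - a) * eps is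
    additive at midpoints, and holds near c since g is nearly constant there. *)
Lemma bisect_sum_cauchy g : continuous01 g -> forall eps, 0 < eps ->
  exists N, forall n m, (N <= n)%N -> (N <= m)%N ->
   `|bisect_sum g n 0 1 - bisect_sum g m 0 1| <= eps.
Proof.
move=> cg eps eps0.
suff [N HN] : exists N, forall n m, (N <= n)%N -> (N <= m)%N ->
   `|bisect_sum g n 0 1 - bisect_sum g m 0 1| <= (1 - 0) * eps.
  by exists N => n m Nn Nm; rewrite (le_trans (HN _ _ Nn Nm))// subr0 mul1r.
pose Q a b := exists N, forall n m, (N <= n)%N -> (N <= m)%N ->
   `|bisect_sum g n a b - bisect_sum g m a b| <= (b - a) * eps.
apply: (@bisection_principle Q) => [a b ab [N1 H1] [N2 H2]|c c01].
  exists (maxn N1 N2).+1 => -[//|n] [//|m]; rewrite !ltnS !geq_max.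
  move=> /andP[n1 n2] /andP[m1 m2] /=; rewrite opprD addrACA.
  apply: le_trans (ler_normD _ _) _.
  by have := H1 _ _ n1 m1; have := H2 _ _ n2 m2; lra.
have [e e0 He] := cg c c01 (eps / 2) (divr_gt0 eps0 (ltr0Sn _ _)).
exists e => // a b a0 b1 /andP[ac cb] bae; exists 0%N => n m _ _.
have ab : a <= b by lra.
have H k : `|bisect_sum g k a b - (b - a) *: g c| <= (b - a) * (eps / 2).
  apply: bisect_sum_approx => // t /andP[at_ tb]; apply: He; first by apply/andP; split; lra.
  by rewrite ltr_norml; apply/andP; split; lra.
rewrite -(subrKA ((b - a) *: g c)).
apply: le_trans (ler_normD _ _) _.
by have := H n; have := H m; rewrite [X in X <= _ -> _]distrC; lra.
Qed.

End bisection.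

Lemma bounded_linear_le (R : realType) (V W : normedModType R) (f : {linear V -> W}) :
  continuous f -> exists2 C, 0 < C & forall x, `|f x| <= C * `|x|.
Proof.
move=> cf; have bf : (f : V -> W) \in @bop_pred R V W.
  by apply/asboolP; split => //; exact: linearP.
exists (bop_norm (Bop bf) + 1) => [|x].
  by rewrite ltr_wpDl// bop_norm_ge0.
apply: le_trans (bop_norm_ge (Bop bf) x) _.
by rewrite ler_wpM2r// lerDl.
Qed.

(** The increment over an interval around a point, minus a Riemann sum, split into
    the errors of the two first order expansions at that point and the error of
    the Riemann sum. *)
Lemma straddle_identity (V : zmodType) (p q r x y z : V) :
  q - p - x = (q - r - y) - (p - r - z) - (x - (y - z)).
Proof.
have -> : (q - r - y) - (p - r - z) = q - p - (y - z).
  by rewrite opprD addrACA (opprB p) subrKA -opprD.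
by rewrite (opprB x) subrKA.
Qed.

(** The Riemann sums of g converge in E because E is complete; iota sends them to
    Riemann sums of the derivative of G, which converge to the increment of G.
    The mean value inequality in E0 alone would only place the increment in the
    closure of the image of a ball, which may leave the range of iota; hence the
    detour through a limit in E. *)
Lemma primitive_in_subspace (R : realType) (E : completeNormedModType R)
    (E0 : normedModType R)
    (iota : {linear E -> E0}) (g : R -> E) (G : R -> E0) :
  continuous iota -> continuous01 g ->
  (forall c, 0 <= c <= 1 -> forall eps, 0 < eps -> exists2 e, 0 < e &
    forall t, 0 <= t <= 1 -> `|t - c| < e ->
      `|G t - G c - (t - c) *: iota (g c)| <= eps * `|t - c|) ->
  exists2 s, iota s = G 1 - G 0 &
    forall v eps, (forall t, 0 <= t <= 1 -> `|g t - v| <= eps) -> `|s - v| <= eps.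
Proof.
move=> ci cg dG.
have [C C0 iC] := bounded_linear_le ci.
pose A n := bisect_sum g n 0 1.
have cA : cvgn A.
  apply/cauchy_cvgP/cauchy_exP => e e0.
  have [N HN] := bisect_sum_cauchy cg (divr_gt0 e0 (ltr0Sn _ 1)).
  exists (A N); exists N => // n /= Nn.
  rewrite -ball_normE /=; apply: le_lt_trans (HN _ _ (leqnn N) Nn) _.
  by lra.
pose s := limn A.
have As : A n @[n --> \oo] --> s by [].
exists s.
  have iAs : iota (A n) @[n --> \oo] --> iota s by apply: cvg_comp As _; exact: ci.
  suff iAG : iota (A n) @[n --> \oo] --> G 1 - G 0 by exact: (cvg_unique _ iAs iAG).
  apply/cvgrPdist_le => eps eps0.
  suff [N HN] : exists N, forall n, (N <= n)%N ->
      `|G 1 - G 0 - iota (bisect_sum g n 0 1)| <= (1 - 0) * eps.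
    by exists N => // n Nn; rewrite (le_trans (HN _ Nn))// subr0 mul1r.
  pose Q a b := exists N, forall n, (N <= n)%N ->
    `|G b - G a - iota (bisect_sum g n a b)| <= (b - a) * eps.
  apply: (@bisection_principle _ Q) => [a b ab [N1 H1] [N2 H2]|c c01].
    exists (maxn N1 N2).+1 => -[//|n]; rewrite !ltnS !geq_max => /andP[n1 n2] /=.
    set m := (a + b) / 2 in H1 H2 *.
    rewrite linearD (_ : _ - _ = (G m - G a - iota (bisect_sum g n a m)) +
       (G b - G m - iota (bisect_sum g n m b))); last first.
      rewrite addrACA -opprD; congr (_ - _); rewrite addrC subrKA //.
    apply: le_trans (ler_normD _ _) _.
    by have := H1 _ n1; have := H2 _ n2; lra.
  have eC0 : 0 < eps / 2 / C by rewrite !divr_gt0.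
  have [e1 e10 He1] := cg c c01 _ eC0.
  have [e2 e20 He2] := dG c c01 (eps / 2) (divr_gt0 eps0 (ltr0Sn _ 1)).
  exists (Num.min e1 e2); first by rewrite lt_min e10.
  move=> a b a0 b1 /andP[ac cb]; rewrite lt_min => /andP[bae1 bae2].
  exists 0%N => n _.
  have h : `|bisect_sum g n a b - (b - a) *: g c| <= (b - a) * (eps / 2 / C).
    apply: bisect_sum_approx; first by lra.
    move=> t /andP[at_ tb]; apply: He1; first by apply/andP; split; lra.
    by rewrite ltr_norml; apply/andP; split; lra.
  have ha : `|G a - G c - (a - c) *: iota (g c)| <= eps / 2 * (c - a).
    have -> : c - a = `|a - c| by rewrite distrC ger0_norm ?subr_ge0.
    by apply: He2; [apply/andP; split; lra|rewrite ltr_norml; apply/andP; split; lra].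
  have hb : `|G b - G c - (b - c) *: iota (g c)| <= eps / 2 * (b - c).
    rewrite [X in _ <= _ * X](_ : b - c = `|b - c|); last by rewrite ger0_norm ?subr_ge0.
    by apply: He2; [apply/andP; split; lra|rewrite ltr_norml; apply/andP; split; lra].
  have hi : `|iota (bisect_sum g n a b - (b - a) *: g c)| <= (b - a) * (eps / 2).
    apply: le_trans (iC _) _; rewrite -ler_pdivlMl//; apply: le_trans h _.
    by rewrite le_eqVlt; apply/orP; left; apply/eqP; ring.
  rewrite (_ : _ - _ = (G b - G c - (b - c) *: iota (g c)) -
     (G a - G c - (a - c) *: iota (g c)) -
     iota (bisect_sum g n a b - (b - a) *: g c)); last first.
    have -> : iota (bisect_sum g n a b - (b - a) *: g c) = iota (bisect_sum g n a b) -
        ((b - c) *: iota (g c) - (a - c) *: iota (g c)).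
      rewrite linearB linearZ /= -scalerBl; congr (_ - _ *: _); ring.
    exact: straddle_identity.
  apply: le_trans (ler_normB _ _) _.
  apply: le_trans (lerD (ler_normB _ _) (lexx _)) _.
  by lra.
move=> v eps Hv.
have H n : `|A n - v| <= eps.
  have := @bisect_sum_approx _ _ g n 0 1 eps v ler01 Hv.
  by rewrite subr0 scale1r mul1r.
have : `|A n - v| @[n --> \oo] --> `|s - v|.
  by apply: cvg_norm; apply: cvgB => //; exact: cvg_cst.
move=> /cvg_lim <- //; apply: limr_le; last by apply: nearW.
by apply/cvg_ex; exists `|s - v|; apply: cvg_norm; apply: cvgB => //; exact: cvg_cst.
Qed.

(** * Frechet derivatives *)

Section frechet_expansions.
Context (R : realType) (V W : normedModType R).

Lemma frechetE (f : V -> W) x : differentiable f x ->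
  frechet f x = 'd f x :> (V -> W).
Proof.
move=> df; rewrite /frechet val_insubd ifT//; apply/asboolP; split.
  exact: linearP.
exact: diff_continuous.
Qed.

Lemma frechet_expansion (f : V -> W) x : differentiable f x ->
  forall eps, 0 < eps -> exists2 e, 0 < e & forall h, `|h| < e ->
    `|f (x + h) - f x - frechet f x h| <= eps * `|h|.
Proof.
move=> df eps eps0; have := diff_locally df.
move=> /eqaddoP/(_ _ eps0)/nbhs_ballP[e /= e0 He].
exists e => // h he; have := He h.
rewrite -ball_normE /= sub0r normrN => /(_ he).
by rewrite frechetE//= !fctE /= opprD addrA (addrC h x).
Qed.

Lemma frechet_unique (f : V -> W) x (T : bop V W) :
  (forall eps, 0 < eps -> exists2 e, 0 < e & forall h, `|h| < e ->
    `|f (x + h) - f x - T h| <= eps * `|h|) ->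
  differentiable f x /\ frechet f x = T.
Proof.
move=> H.
have E : f \o shift x = cst (f x) + T +o_ 0 id.
  apply/eqaddoP => eps eps0; have [e e0 He] := H _ eps0.
  apply/nbhs_ballP; exists e => // h; rewrite -ball_normE /= sub0r normrN => he.
  by have := He h he; rewrite !fctE /= opprD addrA (addrC h x).
have dE : 'd f x = T :> (V -> W).
  by apply: diff_unique => //; exact: bop_continuous.
have df : differentiable f x.
  apply/diff_locallyP; rewrite dE; split => //; exact: bop_continuous.
by split => //; apply/val_inj; rewrite -[RHS]dE; exact: frechetE.
Qed.

(** The form of differentiability along a segment that the bisection principle
    consumes. *)
Lemma segment_expansion (f : V -> W) x h (c : R) :
  differentiable f (x + c *: h) ->
  forall eps, 0 < eps -> exists2 e, 0 < e & forall t, `|t - c| < e ->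
    `|f (x + t *: h) - f (x + c *: h) - (t - c) *: frechet f (x + c *: h) h|
    <= eps * `|t - c|.
Proof.
move=> df eps eps0.
have h0 : 0 < `|h| + 1 by rewrite ltr_wpDl.
have [e e0 He] := frechet_expansion df (divr_gt0 eps0 h0).
exists (e / (`|h| + 1)); first by rewrite divr_gt0.
move=> t; rewrite ltr_pdivlMr// => te.
have th : `|(t - c) *: h| < e.
  by rewrite normrZ; apply: le_lt_trans te; rewrite ler_wpM2l// lerDl.
have := He _ th.
rewrite -(addrA x) -scalerDl (addrC c) subrK linearZ /= => H; apply: le_trans H _.
rewrite normrZ mulrAC ler_pdivrMr// -mulrA ler_wpM2l ?(ltW eps0)//.
by rewrite ler_wpM2l// lerDl.
Qed.

Lemma mean_value_inequality (f : V -> W) x h (M : R) :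
  (forall t, 0 <= t <= 1 -> differentiable f (x + t *: h) /\
     `|frechet f (x + t *: h) h| <= M) ->
  `|f (x + h) - f x| <= M.
Proof.
move=> df; apply/ler_addgt0Pr => eps eps0.
pose Q (a b : R) : Prop := `|f (x + b *: h) - f (x + a *: h)| <= (M + eps) * (b - a).
suff : Q 0 1 by rewrite /Q subr0 mulr1 scale1r scale0r addr0.
have glue (a b c : R) : `|f (x + c *: h) - f (x + a *: h)| <= (M + eps) * (c - a) ->
   `|f (x + b *: h) - f (x + c *: h)| <= (M + eps) * (b - c) -> Q a b.
  move=> H1 H2; rewrite /Q -(subrKA (f (x + c *: h))).
  apply: le_trans (ler_normD _ _) _; apply: le_trans (lerD H2 H1) _.
  by rewrite -mulrDr subrKA.
apply: (@bisection_principle _ Q) => [a b ab|c c01]; first exact: glue.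
have [dfc dM] := df c c01.
have [e e0 He] := segment_expansion dfc eps0.
exists e => // a b a0 b1 /andP[ac cb] bae.
have H t : `|t - c| < e -> `|f (x + t *: h) - f (x + c *: h)| <= (M + eps) * `|t - c|.
  move=> /He H; rewrite -[X in `|X|](subrK ((t - c) *: frechet f (x + c *: h) h)).
  apply: le_trans (ler_normD _ _) _; apply: le_trans (lerD H (lexx _)) _.
  by rewrite normrZ addrC mulrDl lerD2r mulrC ler_wpM2r.
apply: (glue _ _ c).
  have -> : c - a = `|a - c| by rewrite distrC ger0_norm ?subr_ge0.
  by rewrite distrC H// ltr_norml; apply/andP; split; lra.
have -> : b - c = `|b - c| by rewrite ger0_norm ?subr_ge0.
by rewrite H// ltr_norml; apply/andP; split; lra.
Qed.

End frechet_expansions.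

Lemma frechet_comp_linear (R : realType) (U V W : normedModType R)
    (B : {linear U -> V}) (f : V -> W) u :
  continuous B -> differentiable f (B u) ->
  differentiable (f \o B) u /\
  (forall h, frechet (f \o B) u h = frechet f (B u) (B h)).
Proof.
move=> cB df; have dB : differentiable B u by exact: linear_differentiable.
have dfB : differentiable (f \o B) u by exact: differentiable_comp.
split=> // h; rewrite !frechetE// diff_comp//= diff_lin//.
Qed.

(** * The constraint map into the space of continuous functions *)

Lemma bounded_linear_bop (R : realType) (V W : normedModType R) (f : V -> W) (C : R) :
  linear f -> (forall x, `|f x| <= C * `|x|) -> f \in @bop_pred R V W.
Proof.
move=> lf fC; apply/asboolP; split => //.
pose g : {linear V -> W} := HB.pack f (GRing.isLinear.Build R V W *:%R f lf).
apply: (linear_bounded_continuous g).1; apply/linear_boundedP.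
near=> r => x; apply: le_trans (fC x) _.
by rewrite ler_wpM2r//; near: r; exact: nbhs_pinfty_ge.
Unshelve. all: by end_near. Qed.

Lemma bop_sub_apply_le (R : realType) (V W : normedModType R) (S T : bop V W) h (eps : R) :
  0 < eps -> `|S - T| <= eps / (`|h| + 1) -> `|S h - T h| <= eps.
Proof.
move=> eps0 ST; change (`|(S - T) h| <= eps).
have h0 : 0 < `|h| + 1 by rewrite ltr_wpDl.
apply: le_trans (bop_norm_ge _ _) _; apply: le_trans (ler_wpM2r _ ST) _ => //.
by rewrite -mulrA ger_pMr// ler_pdivrMl// mulr1 lerDl.
Qed.

Section uniform_on_compact.
Context {R : realType} {Xi : topologicalType} (hXi : compact [set: Xi]).
Context {W V : normedModType R} (A : set W) (f : W * Xi -> V).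
Hypothesis cf : {within A `*` [set: Xi], continuous f}.

Lemma section_continuous w : A w -> continuous (fun x => f (w, x)).
Proof.
move=> Aw x; have /subspace_continuousP/(_ (w, x)) := cf.
move=> /(_ (conj Aw I)) H.
apply: (cvg_trans _ H) => Q /= [[Q1 Q2] [/= Q1w Q2x] QQ].
apply: filterS Q2x => y Q2y; apply: (QQ (w, y)) => //.
by split=> //; exact: nbhs_singleton.
Qed.

(** The tube lemma: continuity at the points (w0, x) is uniform in x by
    compactness. *)
Lemma uniform_near w0 : A w0 -> forall eps, 0 < eps -> exists2 e, 0 < e &
  forall w, A w -> `|w - w0| < e -> forall x, `|f (w, x) - f (w0, x)| <= eps.
Proof.
move=> Aw0 eps eps0.
have : \forall w \near within A (nbhs w0), [set: Xi] `<=`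
    (fun x => `|f (w, x) - f (w0, x)| <= eps).
  move/compact_near_coveringP : hXi; apply => x _.
  have /subspace_continuousP/(_ (w0, x) (conj Aw0 I)) := cf.
  move=> /cvgrPdist_le/(_ _ (divr_gt0 eps0 (ltr0Sn _ 1))) [[Q1 Q2] [/= Q1w Q2x] QQ].
  exists (Q2, A `&` Q1) => /=; first split=> //.
    by rewrite /within /=; apply: filterS Q1w => w Qw Aw; split.
  move=> [y w] [/= Q2y [Aw Q1w']].
  have h1 := QQ (w, y) (conj Q1w' Q2y) (conj Aw I).
  have h2 := QQ (w0, y) (conj (nbhs_singleton Q1w) Q2y) (conj Aw0 I).
  rewrite /= in h1 h2.
  rewrite -(subrKA (f (w0, x))); apply: le_trans (ler_normD _ _) _.
  by rewrite [X in X + _ <= _]distrC (splitr eps) lerD.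
move=> /nbhs_ballP[e /= e0 He]; exists e => // w Aw we x.
by apply: He => //; rewrite -ball_normE /= distrC.
Qed.

End uniform_on_compact.

Section constraint_map.
Context {R : realType} {d' : measure_display} {Xi : measurableMetricType R d'}.
Context (hXi : compact [set: Xi]) {Z W E0 : normedModType R} {E : completeNormedModType R}.
Context (iota : {linear E -> E0}) (B : {linear dual Z -> W}) (GG : W -> Xi -> E0).
Context (U0 : set (dual Z)) (W0 : set W) (DG : W -> Xi -> bop W E).
Hypotheses (iota_inj : injective iota) (iota_cont : continuous iota).
Hypothesis B_cont : continuous B.
Hypotheses (U0_open : open U0) (B_U0 : B @` U0 `<=` W0).
Hypothesis GG_range : forall (u : dual Z) x, range iota (GG (B u) x).
Hypothesis GG_diff : forall x w, W0 w -> differentiable (GG ^~ x) w.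
Hypothesis GG_continuous : {within (B @` U0) `*` [set: Xi],
     continuous (fun p : W * Xi => in_sub iota (GG p.1 p.2))}.
Hypothesis DGE : forall w x h, (B @` U0) w -> iota (DG w x h) = frechet (GG ^~ x) w h.
Hypothesis DG_continuous : {within (B @` U0) `*` [set: Xi],
       continuous (fun p : W * Xi => DG p.1 p.2)}.

Local Notation calG := (calG hXi iota B GG).

Lemma iota_in_sub u x : iota (in_sub iota (GG (B u) x)) = GG (B u) x.
Proof.
rewrite /in_sub; apply: (@getPex _ (fun e => iota e = GG (B u) x)).
by have [e _ <-] := GG_range u x; exists e.
Qed.

Lemma calGE u x : U0 u -> calG u x = in_sub iota (GG (B u) x).
Proof.
move=> U0u; rewrite /Defs.calG /= val_insubd ifT//; apply/asboolP.
apply: (section_continuous GG_continuous); by exists u.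
Qed.

Lemma iota_calG u x : U0 u -> iota (calG u x) = GG (B u) x.
Proof. by move=> U0u; rewrite calGE// iota_in_sub. Qed.

Lemma calG_uniform u0 : U0 u0 -> forall eps, 0 < eps -> exists2 e, 0 < e &
  forall u, U0 u -> `|B u - B u0| < e -> `|calG u - calG u0| <= eps.
Proof.
move=> U0u0 eps eps0.
have BU0 : (B @` U0) (B u0) by exists u0.
have [e e0 He] := uniform_near hXi GG_continuous BU0 eps0.
exists e => // u U0u Bu; apply: contfun_norm_le => [|x]; first exact: ltW.
by rewrite [_ x]/(calG u x - calG u0 x) !calGE//; apply: He => //; exists u.
Qed.

Lemma DG_bounded u : U0 u -> exists2 M, 0 < M &
  forall x k, `|DG (B u) x k| <= M * `|k|.
Proof.
move=> U0u; have BU0 : (B @` U0) (B u) by exists u.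
have cD : (fun x => DG (B u) x) \in @contfun_pred R Xi (bop W E).
  by apply/asboolP; exact: (section_continuous DG_continuous).
pose D : contfun hXi (bop W E) := ContFun hXi cD.
exists (contfun_norm D + 1) => [|x k]; first by rewrite ltr_wpDl// contfun_norm_ge0.
apply: le_trans (bop_norm_ge _ _) _; apply: ler_wpM2r => //.
by apply: le_trans (contfun_norm_ge D x) _; rewrite lerDl.
Qed.

Lemma calG_derivative_ex u : U0 u -> exists T : bop (dual Z) (contfun hXi E),
  forall h x, T h x = DG (B u) x (B h).
Proof.
move=> U0u; have BU0 : (B @` U0) (B u) by exists u.
have [C C0 BC] := bounded_linear_le B_cont.
have [M M0 DM] := DG_bounded U0u.
have cDh h : (fun x => DG (B u) x (B h)) \in @contfun_pred R Xi E.
  apply/asboolP => x.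
  apply/cvgrPdist_le => eps eps0.
  have h0 : 0 < `|B h| + 1 by rewrite ltr_wpDl.
  have /cvgrPdist_le/(_ _ (divr_gt0 eps0 h0)) := section_continuous DG_continuous BU0 (x := x).
  by apply: filterS => y /= Hy; exact: bop_sub_apply_le.
pose T h : contfun hXi E := ContFun hXi (cDh h).
have lT : linear T.
  by move=> a h k; apply/val_inj/funext => x /=; rewrite !linearP.
have TC h : `|T h| <= (M * C) * `|h|.
  apply: contfun_norm_le => [|x]; first by rewrite !mulr_ge0// ltW.
  by apply: le_trans (DM x _) _; rewrite -mulrA ler_pM2l.
by exists (Bop (bounded_linear_bop lT TC)).
Qed.

(** Along the segment from B u to B (u + h), the increment of calG at x is the
    integral in E of DG applied to B h; this derivative differs from its value at
    B u by little, uniformly in x. *)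
Lemma calG_frechet u : U0 u -> differentiable calG u /\
  forall h x, frechet calG u h x = DG (B u) x (B h).
Proof.
move=> U0u; have BU0 : (B @` U0) (B u) by exists u.
have [T TE] := calG_derivative_ex U0u.
suff [df fE] : differentiable calG u /\ frechet calG u = T.
  by split=> // h x; rewrite fE TE.
apply: frechet_unique => eps eps0.
have [C C0 BC] := bounded_linear_le B_cont.
have [e e0 He] := uniform_near hXi DG_continuous BU0 (divr_gt0 eps0 C0).
have /nbhs_ballP[r /= r0 Hr] : nbhs u U0 by exact: open_nbhs_nbhs.
exists (Num.min r (e / C)); first by rewrite lt_min r0 divr_gt0.
move=> h; rewrite lt_min ltr_pdivlMr// => /andP[hr hC].
have Bh : `|B h| < e by apply: le_lt_trans (BC h) _; rewrite mulrC.
have seg t : 0 <= t <= 1 -> U0 (u + t *: h).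
  move=> /andP[t0 t1]; apply: Hr; rewrite -ball_normE /= opprD addrA subrr sub0r.
  rewrite normrN normrZ ger0_norm//; apply: le_lt_trans hr.
  by rewrite ler_piMl.
have segB t : 0 <= t <= 1 -> (B @` U0) (B u + t *: B h).
  by move=> t01; exists (u + t *: h); [exact: seg|rewrite linearD linearZ].
have U0uh : U0 (u + h) by have := seg 1; rewrite scale1r; apply; rewrite ler01 lexx.
apply: contfun_norm_le => [|x]; first by rewrite mulr_ge0// ltW.
change (`|calG (u + h) x - calG u x - T h x| <= eps * `|h|); rewrite TE.
pose g t := DG (B u + t *: B h) x (B h).
pose G t := GG (B u + t *: B h) x.
have Bh0 : 0 < `|B h| + 1 by rewrite ltr_wpDl.
have cg : continuous01 g.
  move=> c c01 eta eta0.
  have [e1 e10 He1] := uniform_near hXi DG_continuous (segB c c01) (divr_gt0 eta0 Bh0).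
  exists (e1 / (`|B h| + 1)); first by rewrite divr_gt0.
  move=> t t01; rewrite ltr_pdivlMr// => tc.
  have lt1 : `|B u + t *: B h - (B u + c *: B h)| < e1.
    rewrite opprD addrACA subrr add0r -scalerBl normrZ; apply: le_lt_trans tc.
    by rewrite ler_wpM2l// lerDl.
  by apply: bop_sub_apply_le => //; exact: (He1 _ (segB t t01) lt1 x).
have dG c : 0 <= c <= 1 -> forall eps, 0 < eps -> exists2 e, 0 < e &
    forall t, 0 <= t <= 1 -> `|t - c| < e ->
      `|G t - G c - (t - c) *: iota (g c)| <= eps * `|t - c|.
  move=> c01 eta eta0; rewrite /g DGE; last exact: segB.
  have dGG : differentiable (GG ^~ x) (B u + c *: B h).
    by apply: GG_diff; apply: B_U0; exact: segB.
  have [e1 e10 He1] := segment_expansion dGG eta0.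
  by exists e1 => // t _ tc; exact: He1.
have [s iotas sv] := primitive_in_subspace iota_cont cg dG.
have -> : calG (u + h) x - calG u x = s.
  apply: iota_inj; rewrite linearB /= !iota_calG// iotas /G.
  by rewrite scale1r scale0r addr0 linearD.
apply: sv => t t01; rewrite /g.
have lt1 : `|B u + t *: B h - B u| < e.
  rewrite addrC addKr normrZ; apply: le_lt_trans Bh.
  by case/andP: t01 => t0 t1; rewrite ger0_norm// ler_piMl.
have := He _ (segB t t01) lt1 x => /= H.
apply: le_trans (bop_norm_ge (DG (B u + t *: B h) x - DG (B u) x) (B h)) _.
apply: le_trans (ler_wpM2r _ H) _ => //.
apply: le_trans (ler_wpM2l _ (BC h)) _; first by rewrite divr_ge0// ltW.
by rewrite mulrA divfK// gt_eqF.
Qed.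

Lemma calG_cvg (u : nat -> dual Z) u0 : U0 u0 -> (forall n, U0 (u n)) ->
  B (u n) @[n --> \oo] --> B u0 -> calG (u n) @[n --> \oo] --> calG u0.
Proof.
move=> U0u0 U0u Bu; apply/cvgrPdist_le => eps eps0.
have [e e0 He] := calG_uniform U0u0 eps0.
move/cvgrPdist_lt: Bu => /(_ _ e0); apply: filterS => n.
by move=> H; rewrite distrC; apply: He => //; rewrite distrC.
Qed.

Lemma frechet_calG_cvg (u h : nat -> dual Z) u0 h0 : U0 u0 -> (forall n, U0 (u n)) ->
  B (u n) @[n --> \oo] --> B u0 -> B (h n) @[n --> \oo] --> B h0 ->
  frechet calG (u n) (h n) @[n --> \oo] --> frechet calG u0 h0.
Proof.
move=> U0u0 U0u Bu Bh; apply/cvgrPdist_le => eps eps0.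
have BU0 : (B @` U0) (B u0) by exists u0.
have [M M0 DM] := DG_bounded U0u0.
have h00 : 0 < `|B h0| + 1 by rewrite ltr_wpDl.
pose e1 := eps / 2 / (`|B h0| + 1).
have e10 : 0 < e1 by rewrite !divr_gt0.
have [e e0 He] := uniform_near hXi DG_continuous BU0 e10.
near=> n.
have Bun : `|B (u n) - B u0| < e.
  by rewrite distrC; near: n; move/cvgrPdist_lt: Bu; exact.
have Bhn : `|B h0 - B (h n)| < eps / 2 / M.
  by near: n; move/cvgrPdist_lt: Bh; apply; rewrite !divr_gt0.
have Bhn1 : `|B h0 - B (h n)| < 1.
  by near: n; move/cvgrPdist_lt: Bh; exact.
rewrite distrC; apply: contfun_norm_le => [|x]; first exact: ltW.
change (`|frechet calG (u n) (h n) x - frechet calG u0 h0 x| <= eps).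
rewrite (calG_frechet (U0u n)).2 (calG_frechet U0u0).2.
rewrite -(subrKA (DG (B u0) x (B (h n)))) (splitr eps).
apply: le_trans (ler_normD _ _) _; apply: lerD.
  apply: le_trans (bop_norm_ge (DG (B (u n)) x - DG (B u0) x) (B (h n))) _.
  have BU0n : (B @` U0) (B (u n)) by exists (u n).
  apply: le_trans (ler_wpM2r _ (He _ BU0n Bun x)) _ => //.
  apply: le_trans (_ : e1 * (`|B h0| + 1) <= _); last by rewrite /e1 divfK// gt_eqF.
  apply: ler_wpM2l; first exact: ltW.
  rewrite -[B (h n)](subrK (B h0)); apply: le_trans (ler_normD _ _) _.
  by rewrite addrC lerD2l distrC ltW.
have -> : DG (B u0) x (B (h n)) - DG (B u0) x (B h0) = DG (B u0) x (B (h n) - B h0).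
  by rewrite linearB.
apply: le_trans (DM _ _) _.
by rewrite -ler_pdivlMl// mulrC distrC ltW.
Unshelve. all: by end_near. Qed.

End constraint_map.

(** * Measurability and the expected objective *)

(** A sequence is more convenient than a countable dense set: almost sure events
    can then be intersected over its indices. *)
Lemma dense_sequence (R : realType) (T : pseudoPMetricType R) :
  separable T -> exists s : nat -> T, forall x (e : R), 0 < e -> exists n, ball x e (s n).
Proof.
move=> [D /countable_injP[f finj] dD].
exists (fun n => get [set d | D d /\ f d = n]) => x e e0.
have xe : (ball x e)^° x by exact: nbhsx_ballx.
have [d [/interior_subset xd Dd]] := dD _ (ex_intro _ x xe) (@open_interior _ _).
exists (f d); set P := [set _ | _].
have [Dg fg] : P (get P) by apply: (@getPex _ P); exists d.
by rewrite (finj (get P) d) ?inE.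
Qed.

Section measurability.
Context {R : realType} d' {X : measurableType d'}.

Lemma borel_measurable_apply (V : normedModType R) (f : X -> bop V R^o) (h : V) :
  borel_measurable f -> measurable_fun [set: X] (fun x => f x h : R).
Proof.
move=> mf; apply: (measurability _ (RGenOInfty.measurableE R)) => //.
move=> _ [_ [a ->] <-]; rewrite setTI.
pose O : set (bop V R^o) := [set T | a < T h].
have oO : open O.
  rewrite openE => T /= aT; apply/nbhs_ballP.
  have h0 : 0 < `|h| + 1 by rewrite ltr_wpDl.
  have aT0 : 0 < T h - a by rewrite subr_gt0.
  exists ((T h - a) / (`|h| + 1)); first by rewrite /= divr_gt0.
  move=> S; rewrite -ball_normE /= ltr_pdivlMr// => TS.
  have : `|(T - S) h| < T h - a.
    apply: le_lt_trans (bop_norm_ge _ _) _; apply: le_lt_trans TS.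
    by apply: (ler_wpM2l (normr_ge0 (T - S))); rewrite lerDl.
  by rewrite [(T - S) h]/(T h - S h) ltr_norml /O /= => /andP[_]; rewrite ltrD2l ltrN2.
have /(_ measurableT) := mf; move=> /(_ O); rewrite setTI.
rewrite (_ : _ @^-1` `]a, +oo[ = f @^-1` O); last first.
  by apply/seteqP; split => x /=; rewrite in_itv /= andbT.
by apply; exact: sub_sigma_algebra.
Qed.

(** Since the epigraph is closed, J w x <= a exactly when the epigraph of J at x
    meets every ball around (w, a), a countable intersection of measurable
    events. *)
Lemma random_lsc_measurable (W : normedModType R) (J : W -> X -> R) w :
  random_lsc J -> measurable_fun [set: X] (J w).
Proof.
move=> [Jc Jm]; apply: (measurability _ (RGenOInfty.measurableE R)) => //.
move=> _ [_ [a ->] <-]; rewrite setTI.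
rewrite (_ : _ @^-1` _ = ~` (\bigcap_n
   [set x | [set p : W * R^o | J p.1 x <= p.2] `&`
      ball ((w, a) : W * R^o) n.+1%:R^-1 !=set0])).
  apply: measurableC; apply: bigcapT_measurable => n; apply: Jm.
  exact: ball_open.
apply/seteqP; split => x /=; rewrite in_itv /= andbT.
  move=> aJ H; have := Jc x; rewrite closedE => /(_ (w, a)).
  have : ~ (J w x <= a) by apply/negP; rewrite -ltNge.
  move=> nJ Hc; apply: nJ; apply: Hc.
  move=> /nbhs_ballP[e /= e0 He].
  have [n ne] : exists n, n.+1%:R^-1 < e.
    exists (Num.truncn e^-1); rewrite invf_plt ?posrE//; exact: truncnS_gt.
  have [p [Jp bp]] := H n I.
  by apply: (He p) => //; apply: le_ball (ltW ne) _ bp.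
move=> H; rewrite ltNge; apply/negP => Ja; apply: H => n _.
exists (w, a); split => //; exact: ballxx.
Qed.

End measurability.

Lemma Rintegral_dominated_cvg (R : realType) d (X : measurableType d)
    (mu : probability X R) (f_ : nat -> X -> R) (f g : X -> R) :
  (forall n, measurable_fun [set: X] (f_ n)) -> measurable_fun [set: X] f ->
  mu.-integrable [set: X] (EFin \o g) ->
  (forall n x, `|f_ n x| <= g x) -> (forall x, f_ n x @[n --> \oo] --> f x) ->
  \int[mu]_x f_ n x @[n --> \oo] --> \int[mu]_x f x.
Proof.
move=> mf_ mf intg fg ff.
have ffE x : (f_ n x)%:E @[n --> \oo] --> (f x)%:E.
  by apply: cvg_EFin; [exact: nearW|exact: ff].
have [intf _ H] := @dominated_convergence _ _ _ mu setT measurableT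
  (fun n x => (f_ n x)%:E) (EFin \o f) (EFin \o g)
  (fun n => (measurable_EFinP _ _).2 (mf_ n)) ((measurable_EFinP _ _).2 mf)
  (aeW _ (fun x _ => ffE x))
  intg (aeW _ (fun x n _ => fg n x)).
by apply: fine_cvg; rewrite /= fineK//; exact: integrable_fin_num.
Qed.

Section random_objective.
Context {R : realType} {d'} {X : measurableType d'} (mu : probability X R).
Context {W : normedModType R} (J : W -> X -> R) (W0 : set W) (L : X -> R).
Hypothesis J_measurable : forall w, measurable_fun [set: X] (J w).
Hypothesis J_diff : forall x w, W0 w -> differentiable (J ^~ x : W -> R^o) w.
Hypothesis DJ_measurable : forall w h, W0 w ->
  measurable_fun [set: X] (fun x => frechet (J ^~ x : W -> R^o) w h : R).
Hypothesis DJ_bound : forall w x, W0 w -> `|frechet (J ^~ x : W -> R^o) w| <= L x.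
Hypothesis L_integrable : mu.-integrable [set: X] (EFin \o L).

Local Notation DJ w x := (frechet (J ^~ x : W -> R^o) w).

Lemma DJ_le w x h : W0 w -> `|DJ w x h| <= L x * `|h|.
Proof.
move=> W0w; apply: le_trans (bop_norm_ge _ _) _.
by apply: ler_wpM2r => //; exact: DJ_bound.
Qed.

Lemma J_lipschitz w k x : (forall t, 0 <= t <= 1 -> W0 (w + t *: k)) ->
  `|J (w + k) x - J w x| <= L x * `|k|.
Proof.
move=> seg; apply: (@mean_value_inequality _ _ R^o (J ^~ x)) => t t01.
by split; [apply: J_diff; exact: seg|apply: DJ_le; exact: seg].
Qed.

Lemma integrable_L_scale (c : R) : mu.-integrable [set: X] (EFin \o (fun x => L x * c)).
Proof.
under [X in integrable _ _ X]eq_fun do rewrite /= EFinM muleC.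
exact: integrableZl.
Qed.

Lemma integrable_DJ w h : W0 w -> mu.-integrable [set: X] (EFin \o (fun x => DJ w x h : R)).
Proof.
move=> W0w; apply: le_integrable (integrable_L_scale `|h|) => //.
  by apply/measurable_EFinP; exact: DJ_measurable.
by move=> x _; rewrite /= lee_fin (le_trans (DJ_le x h W0w))// ler_norm.
Qed.

(** Finiteness of the expected objective at one feasible point spreads to every
    point that is joined to it by a segment in W0, by the Lipschitz bound. *)
Lemma integrable_J_segment w k : (forall t, 0 <= t <= 1 -> W0 (w + t *: k)) ->
  mu.-integrable [set: X] (EFin \o J w) -> mu.-integrable [set: X] (EFin \o J (w + k)).
Proof.
move=> seg iJ.
have iD : mu.-integrable [set: X] (EFin \o (fun x => J (w + k) x - J w x)).
  apply: le_integrable (integrable_L_scale `|k|) => //.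
    by apply/measurable_EFinP; exact: measurable_funB.
  by move=> x _; rewrite /= lee_fin (le_trans (J_lipschitz _ seg))// ler_norm.
have := integrableD measurableT iD iJ; apply: eq_integrable => // x _ /=.
by rewrite -EFinD subrK.
Qed.

Lemma DJ_int_ex w : W0 w -> exists T : bop W R^o, forall h, T h = \int[mu]_x (DJ w x h).
Proof.
move=> W0w; pose T h : R^o := \int[mu]_x (DJ w x h : R).
have lT : linear T.
  move=> a h k; rewrite /T.
  transitivity (\int[mu]_x (a * (DJ w x h : R) + (DJ w x k : R))).
    by apply: eq_Rintegral => x _; rewrite linearP.
  rewrite RintegralD//; last exact: integrable_DJ.
    by rewrite RintegralZl//; exact: integrable_DJ.
  under [X in integrable _ _ X]eq_fun do rewrite /= EFinM.
  by apply: integrableZl => //; exact: integrable_DJ.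
have TC h : `|T h| <= \int[mu]_x (L x) * `|h|.
  apply: le_trans (le_normr_Rintegral _ _) _ => //; first exact: integrable_DJ.
  rewrite -RintegralZr//; apply: le_Rintegral => //.
  - apply: le_integrable (integrable_DJ h W0w) => //.
      apply/measurable_EFinP; apply: measurableT_comp => //; exact: DJ_measurable.
    by move=> x _ /=; rewrite lee_fin normr_id.
  - exact: integrable_L_scale.
  - by move=> x _; exact: DJ_le.
by exists (Bop (bounded_linear_bop lT TC)).
Qed.

(** If the first order expansion failed, it would fail along a sequence h n tending
    to 0. The normalised remainders at x tend to 0 by differentiability and are
    dominated by a multiple of L, so their mean tends to 0: a contradiction. *)
Lemma expectation_frechet (U : normedModType R) (B : {linear U -> W}) (U0 : set U) u :
  continuous B -> open U0 -> (forall v, U0 v -> W0 (B v)) -> U0 u ->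
  mu.-integrable [set: X] (EFin \o J (B u)) ->
  let Phi : U -> R^o := fun v => \int[mu]_x J (B v) x in
  differentiable Phi u /\
  forall h, frechet Phi u h = \int[mu]_x (DJ (B u) x (B h)).
Proof.
move=> cB oU0 BU0 U0u iJ Phi.
have W0u := BU0 u U0u.
have [S SE] := DJ_int_ex W0u.
have [C C0 BC] := bounded_linear_le cB.
have SBC h : `|S (B h)| <= (bop_norm S * C) * `|h|.
  apply: le_trans (bop_norm_ge S _) _; rewrite -mulrA.
  by rewrite ler_wpM2l// bop_norm_ge0.
have lSB : linear (S \o B) by move=> a h k /=; rewrite !linearP.
pose T : bop U R^o := Bop (bounded_linear_bop lSB SBC).
suff [dPhi PhiE] : differentiable Phi u /\ frechet Phi u = T.
  by split=> // h; rewrite PhiE -SE.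
have /nbhs_ballP[r /= r0 Hr] : nbhs u U0 by exact: open_nbhs_nbhs.
have seg h t : `|h| < r -> 0 <= t <= 1 -> W0 (B u + t *: B h).
  move=> hr /andP[t0 t1]; rewrite -linearZ -linearD; apply/BU0/Hr.
  rewrite -ball_normE /= opprD addrA subrr sub0r.
  rewrite normrN normrZ ger0_norm//; apply: le_lt_trans hr.
  by rewrite ler_piMl.
apply: frechet_unique => eps eps0; apply: contrapT => nH.
have {nH} H n : exists h, [/\ `|h| < r, `|h| < n.+1%:R^-1 &
    eps * `|h| < `|Phi (u + h) - Phi u - T h|].
  apply: contrapT => nh; apply: nH.
  exists (Num.min r n.+1%:R^-1); first by rewrite lt_min r0 invr_gt0 ltr0n.
  move=> h; rewrite lt_min => /andP[hr hn].
  by rewrite leNgt; apply/negP => Hh; apply: nh; exists h.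
have {H} [h H] := choice H.
have h0 n : 0 < `|h n|.
  rewrite normr_gt0; apply/eqP => hn0; have [_ _] := H n.
  by rewrite hn0 normr0 mulr0 addr0 subrr sub0r linear0 normrN normr0 ltxx.
have hcvg : h n @[n --> \oo] --> 0.
  apply/cvgrPdist_lt => e e0.
  near=> n; rewrite sub0r normrN; have [_ hn _] := H n.
  apply: lt_trans hn _; near: n.
  exact: (near_infty_natSinv_lt (PosNum e0)).
pose Q n x : R := `|h n|^-1 * (J (B u + B (h n)) x - J (B u) x - (DJ (B u) x (B (h n)) : R)).
have QL n x : `|Q n x| <= L x * (2 * C).
  have [hr _ _] := H n.
  rewrite /Q normrM normfV normr_id ler_pdivrMl//.
  apply: le_trans (ler_normB _ _) _.
  have h1 := J_lipschitz x (fun t => seg _ t hr).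
  have h2 := DJ_le x (B (h n)) W0u.
  apply: le_trans (lerD h1 h2) _.
  have L0 : 0 <= L x by apply: le_trans (DJ_bound x W0u).
  have := ler_wpM2l L0 (BC (h n)).
  by lra.
have Q0 x : Q n x @[n --> \oo] --> 0.
  apply/cvgrPdist_le => e e0.
  have eC : 0 < e / C by rewrite divr_gt0.
  have [d d0 Hd] := frechet_expansion (J_diff x W0u) eC.
  near=> n; rewrite sub0r normrN /Q normrM normfV normr_id ler_pdivrMl//.
  apply: le_trans (Hd _ _) _.
    apply: le_lt_trans (BC _) _; rewrite mulrC -ltr_pdivlMr//.
    near: n; move/cvgrPdist_lt: hcvg => /(_ _ (divr_gt0 d0 C0)).
    by apply: filterS => n; rewrite sub0r normrN.
  apply: le_trans (ler_wpM2l (ltW eC) (BC _)) _.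
  by rewrite mulrA divfK ?gt_eqF// mulrC.
have mQ n : measurable_fun [set: X] (Q n).
  apply: measurable_funM => //; apply: measurable_funB; last exact: DJ_measurable.
  exact: measurable_funB.
have iQ := @Rintegral_dominated_cvg _ _ _ mu Q (fun=> 0 : R) _ mQ (measurable_cst (0 : R))
  (integrable_L_scale (2 * C)) QL Q0.
have : \forall n \near \oo, `|\int[mu]_x Q n x| <= eps.
  move/cvgrPdist_le: iQ => /(_ _ eps0); apply: filterS => n.
  by rewrite Rintegral_cst// mul0r sub0r normrN.
case=> n _ /(_ n (leqnn n)); apply/negP; rewrite -ltNge.
have [hr _ hn] := H n.
have -> : \int[mu]_x Q n x = `|h n|^-1 * (Phi (u + h n) - Phi u - T (h n)).
  have iJn := integrable_J_segment (fun t => seg _ t hr) iJ.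
  have iD := integrable_DJ (B (h n)) W0u.
  have iJJ : mu.-integrable [set: X] (EFin \o (fun x => J (B u + B (h n)) x - J (B u) x)).
    by under [X in integrable _ _ X]eq_fun do rewrite /= EFinB; exact: integrableB.
  rewrite /Q RintegralZl//; last first.
    by under [X in integrable _ _ X]eq_fun do rewrite /= EFinB; exact: integrableB.
  by rewrite RintegralB// RintegralB// /Phi linearD /= -SE.
by rewrite normrM normfV normr_id ltr_pdivlMl// mulrC.
Unshelve. all: by end_near. Qed.

End random_objective.

(** * A uniform law of large numbers for derivatives *)

Section uniform_law.
Context {R : realType} {d'} {X : measurableType d'} (mu : probability X R).
Context {W : normedModType R} (J : W -> X -> R) (W0 : set W) (L : X -> R).
Hypothesis W0_open : open W0.
Hypothesis DJ_measurable : forall w h, W0 w ->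
  measurable_fun [set: X] (fun x => frechet (J ^~ x : W -> R^o) w h : R).
Hypothesis DJ_continuous : forall x, {within W0, continuous (frechet (J ^~ x : W -> R^o))}.
Hypothesis DJ_bound : forall w x, W0 w -> `|frechet (J ^~ x : W -> R^o) w| <= L x.
Hypothesis L_ge0 : forall x, 0 <= L x.
Hypothesis L_integrable : mu.-integrable [set: X] (EFin \o L).
Context (ws : nat -> W).
Hypothesis ws_dense : forall w (e : R), 0 < e -> exists n, ball w e (ws n).

Local Notation DJ w x := (frechet (J ^~ x : W -> R^o) w).

Lemma DJ_near x w : W0 w -> forall eps, 0 < eps -> exists2 e, 0 < e &
  forall w', `|w' - w| < e -> W0 w' /\ `|DJ w' x - DJ w x| <= eps.
Proof.
move=> W0w eps eps0.
have /subspace_continuousP/(_ w W0w)/cvgrPdist_le/(_ _ eps0) := @DJ_continuous x.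
rewrite /= => /nbhs_ballP[e /= e0 He].
have /nbhs_ballP[r /= r0 Hr] : nbhs w W0 by exact: open_nbhs_nbhs.
exists (Num.min e r); first by rewrite lt_min e0.
move=> w'; rewrite lt_min distrC => /andP[w'e w'r].
have W0w' : W0 w' by apply: Hr; rewrite -ball_normE.
by split => //; rewrite distrC; apply: He => //; rewrite -ball_normE.
Qed.

(** Indices that do not name a point of W0 in the ball of radius 1/(j+1) around
    [ws i] contribute the lower bound - L x * |h|, h := [ws l], of every directional
    derivative in direction h; this keeps the supremum below finite and does not
    change it when the ball meets W0. *)
Definition local_candidate i j l n x : R :=
  if `[< W0 (ws n) /\ `|ws n - ws i| < j.+1%:R^-1 >] then DJ (ws n) x (ws l)
  else - (L x * `|ws l|).

(** A countable supremum, hence measurable in x; by continuity of the derivative it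
    is also the supremum over the whole part of W0 in the ball. *)
Definition local_sup i j l x : R := sups (fun n => local_candidate i j l n x) 0%N.

Lemma local_candidate_bound i j l n x : `|local_candidate i j l n x| <= L x * `|ws l|.
Proof.
rewrite /local_candidate; case: asboolP => [[W0n _]|_]; first exact: (DJ_le DJ_bound).
by rewrite normrN ger0_norm// mulr_ge0.
Qed.

Lemma local_candidate_ub i j l x :
  has_ubound (range (fun n => local_candidate i j l n x)).
Proof.
exists (L x * `|ws l|) => _ [n _ <-].
exact: le_trans (ler_norm _) (local_candidate_bound i j l n x).
Qed.

Lemma local_candidate_le_sup i j l n x : local_candidate i j l n x <= local_sup i j l x.
Proof.
apply: ub_le_sup; last by exists n.
by have [M HM] := local_candidate_ub i j l x; exists M => _ [k _ <-]; apply: HM; exists k.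
Qed.

Lemma local_sup_le i j l x c : (forall n, local_candidate i j l n x <= c) ->
  local_sup i j l x <= c.
Proof.
move=> H; apply: ge_sup => [|_ [n _ <-]]; last exact: H.
by exists (local_candidate i j l 0%N x), 0%N.
Qed.

Lemma local_sup_bound i j l x : `|local_sup i j l x| <= L x * `|ws l|.
Proof.
rewrite ler_norml; apply/andP; split.
  apply: le_trans (local_candidate_le_sup i j l 0%N x).
  by have := local_candidate_bound i j l 0%N x; rewrite ler_norml => /andP[].
by apply: local_sup_le => n; apply: le_trans (ler_norm _) (local_candidate_bound i j l n x).
Qed.

Lemma measurable_L : measurable_fun [set: X] L.
Proof. by apply/measurable_EFinP; exact: measurable_int L_integrable. Qed.

Lemma measurable_local_sup i j l : measurable_fun [set: X] (local_sup i j l).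
Proof.
apply: measurable_fun_sups => [x _|n]; first exact: local_candidate_ub.
rewrite /local_candidate; case: asboolP => [[W0n _]|_]; first exact: DJ_measurable.
by apply: measurable_funN; apply: measurable_funM => //; exact: measurable_L.
Qed.

Lemma DJ_le_local_sup i j l w x : W0 w -> `|w - ws i| < j.+1%:R^-1 ->
  DJ w x (ws l) <= local_sup i j l x.
Proof.
move=> W0w wi; apply/ler_addgt0Pr => eps eps0.
have l0 : 0 < `|ws l| + 1 by rewrite ltr_wpDl.
have [e e0 He] := DJ_near x W0w (divr_gt0 eps0 l0).
have m0 : 0 < Num.min e (j.+1%:R^-1 - `|w - ws i|) by rewrite lt_min e0 subr_gt0.
have [n] := ws_dense w m0; rewrite -ball_normE /= distrC lt_min => /andP[ne nj].
have [W0n Dn] := He _ ne.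
have := local_candidate_le_sup i j l n x.
rewrite /local_candidate asboolT; last first.
  split => //; rewrite -(subrKA w); apply: le_lt_trans (ler_normD _ _) _.
  by rewrite -ltrBrDr.
have := bop_sub_apply_le eps0 Dn.
rewrite distrC ler_norml lerBlDr => /andP[_ H] Ha; apply: le_trans H _.
by rewrite [leRHS]addrC lerD2l.
Qed.

(** The balls shrink to w and contain it, so continuity of the derivative at w
    pins the suprema down. *)
Lemma cvg_local_sup l w x (i : nat -> nat) : W0 w ->
  (forall k, `|ws (i k) - w| < k.+1%:R^-1) ->
  local_sup (i k) k l x @[k --> \oo] --> (DJ w x (ws l) : R).
Proof.
move=> W0w wi; apply/cvgrPdist_le => eps eps0.
have l0 : 0 < `|ws l| + 1 by rewrite ltr_wpDl.
have [e e0 He] := DJ_near x W0w (divr_gt0 eps0 l0).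
near=> k.
have ke : k.+1%:R^-1 < e / 2.
  near: k; exact: (near_infty_natSinv_lt (PosNum (divr_gt0 e0 (ltr0Sn _ 1)))).
have lo : DJ w x (ws l) <= local_sup (i k) k l x.
  by apply: DJ_le_local_sup => //; rewrite distrC.
rewrite distrC ger0_norm ?subr_ge0//; rewrite lerBlDr; apply: local_sup_le => n.
rewrite /local_candidate; case: asboolP => [[W0n nk]|_]; last first.
  have := DJ_le DJ_bound x (ws l) W0w; rewrite ler_norml => /andP[H _].
  by apply: le_trans H _; rewrite lerDr ltW.
have nw : `|ws n - w| < e.
  rewrite -(subrKA (ws (i k))); apply: le_lt_trans (ler_normD _ _) _.
  by rewrite (splitr e) ltrD// (lt_trans _ ke).
have [_ Dn] := He _ nw.
have := bop_sub_apply_le eps0 Dn.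
by rewrite ler_norml lerBlDr => /andP[_].
Unshelve. all: by end_near. Qed.


Definition sample_average (y : nat -> X) (N : nat) (f : X -> R) : R :=
  N%:R^-1 * \sum_(i < N) f (y i).

Lemma sample_average_le y N f g : (forall x, f x <= g x) ->
  sample_average y N f <= sample_average y N g.
Proof. by move=> fg; rewrite ler_wpM2l ?invr_ge0//; apply: ler_sum. Qed.

Lemma sample_averageD y N f g :
  sample_average y N (fun x => f x + g x) = sample_average y N f + sample_average y N g.
Proof. by rewrite /sample_average big_split mulrDr. Qed.

Lemma sample_averageZ y N f c :
  sample_average y N (fun x => f x * c) = sample_average y N f * c.
Proof. by rewrite /sample_average -mulr_suml mulrA. Qed.

Lemma DJ_shift w x h k : W0 w -> (DJ w x h : R) <= DJ w x k + L x * `|h - k|.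
Proof.
move=> W0w; have := DJ_le DJ_bound x (h - k) W0w.
by rewrite linearB ler_norml lerBlDr => /andP[_]; rewrite [leRHS]addrC.
Qed.

Section averages.
Context (y : nat -> X).
Hypothesis avg_local_sup : forall i j l,
  sample_average y n (local_sup i j l) @[n --> \oo] --> \int[mu]_x local_sup i j l x.
Hypothesis avg_L : sample_average y n L @[n --> \oo] --> \int[mu]_x L x.
Context (w_ : nat -> W) (w : W) (h_ : nat -> W) (h : W) (N_ : nat -> nat).
Hypotheses (W0w_ : forall n, W0 (w_ n)) (W0w : W0 w).
Hypotheses (w_w : w_ n @[n --> \oo] --> w).
Hypothesis N_oo : N_ n @[n --> \oo] --> \oo.

(** First the direction h n is replaced by a nearby [ws l], at a cost bounded by
    averages of L; then w_ n is eventually in a fixed ball around w, so that the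
    average is at most that of the supremum over this ball, whose mean is close
    to the mean derivative at w. *)
Lemma uniform_average_le : h_ n @[n --> \oo] --> h -> forall eps, 0 < eps ->
  \forall n \near \oo, sample_average y (N_ n) (fun x => DJ (w_ n) x (h_ n) : R)
    <= \int[mu]_x (DJ w x h : R) + eps.
Proof.
move=> h_h eps eps0.
set M := \int[mu]_x L x.
have M0 : 0 <= M by apply: Rintegral_ge0.
have M2 : 0 < 3 * M + 2 by lra.
(* The direction costs eta * M in the mean and 2 * eta * (M + 1) in the average. *)
pose eta := eps / 2 / (3 * M + 2).
have eta0 : 0 < eta by rewrite !divr_gt0.
have etaE : eta * (3 * M + 2) = eps / 2 by rewrite /eta divfK// gt_eqF.
have [l] := ws_dense h eta0; rewrite -ball_normE /= => hl.
have iDJ k : mu.-integrable [set: X] (EFin \o (fun x => DJ w x k : R)).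
  exact: (integrable_DJ DJ_measurable DJ_bound L_integrable).
have Il : \int[mu]_x (DJ w x (ws l) : R) <= \int[mu]_x (DJ w x h : R) + M * eta.
  apply: (@le_trans _ _ (\int[mu]_x ((DJ w x h : R) + L x * `|ws l - h|))).
    apply: le_Rintegral => //; last by move=> x _; exact: DJ_shift.
    have := integrableD measurableT (iDJ h) (integrable_L_scale L_integrable `|ws l - h|).
    exact: eq_integrable.
  rewrite RintegralD//; last exact: integrable_L_scale.
  by rewrite lerD2l RintegralZr// ler_wpM2l// distrC ltW.
have /choice[i wi] k : exists n, `|ws n - w| < k.+1%:R^-1.
  have k0 : 0 < k.+1%:R^-1 :> R by rewrite invr_gt0 ltr0n.
  by have [n] := ws_dense w k0; rewrite -ball_normE /= distrC; exists n.
have [k Gk] : exists k, \int[mu]_x local_sup (i k) k l x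
    <= \int[mu]_x (DJ w x (ws l) : R) + eps / 4.
  have : \int[mu]_x local_sup (i k) k l x @[k --> \oo] --> \int[mu]_x (DJ w x (ws l) : R).
    apply: (Rintegral_dominated_cvg _ _ (integrable_L_scale L_integrable `|ws l|)).
    - by move=> k; exact: measurable_local_sup.
    - exact: DJ_measurable.
    - by move=> k x; exact: local_sup_bound.
    - by move=> x; exact: cvg_local_sup.
  have e4 : 0 < eps / 4 by lra.
  move=> /cvgrPdist_le/(_ _ e4)[k _ /(_ k (leqnn k))]; rewrite distrC ler_norml => /andP[_ H].
  by exists k; rewrite -lerBlDl.
have k0 : 0 < k.+1%:R^-1 - `|w - ws (i k)| by rewrite subr_gt0 distrC.
have cG : sample_average y (N_ n) (local_sup (i k) k l) @[n --> \oo]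
    --> \int[mu]_x local_sup (i k) k l x.
  exact: (cvg_comp N_ (fun N => sample_average y N (local_sup (i k) k l)) N_oo
    (@avg_local_sup (i k) k l)).
have cL : sample_average y (N_ n) L @[n --> \oo] --> M.
  exact: (cvg_comp N_ (fun N => sample_average y N L) N_oo avg_L).
near=> n.
have wn : `|w_ n - ws (i k)| < k.+1%:R^-1.
  rewrite -(subrKA w); apply: le_lt_trans (ler_normD _ _) _; rewrite -ltrBrDr distrC.
  by near: n; move/cvgrPdist_lt: w_w; exact.
have hn : `|h_ n - ws l| <= 2 * eta.
  rewrite -(subrKA h); apply: le_trans (ler_normD _ _) _.
  rewrite mulr_natl mulr2n lerD//; last exact: ltW.
  by rewrite distrC; near: n; move/cvgrPdist_le: h_h; exact.
have Gn : sample_average y (N_ n) (local_sup (i k) k l)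
    <= \int[mu]_x local_sup (i k) k l x + eps / 4.
  have : `|\int[mu]_x local_sup (i k) k l x - sample_average y (N_ n) (local_sup (i k) k l)| <= eps / 4.
    near: n; move/cvgrPdist_le: cG; apply; lra.
  by rewrite ler_norml => /andP[]; lra.
have Ln : sample_average y (N_ n) L <= M + 1.
  have : `|M - sample_average y (N_ n) L| <= 1.
    near: n; move/cvgrPdist_le: cL; exact.
  by rewrite ler_norml => /andP[]; lra.
apply: (@le_trans _ _ (sample_average y (N_ n) (fun x => local_sup (i k) k l x + L x * (2 * eta)))).
  apply: sample_average_le => x; apply: le_trans (DJ_shift x (h_ n) (ws l) (W0w_ n)) _.
  by apply: lerD; [exact: DJ_le_local_sup|exact: ler_wpM2l].
rewrite sample_averageD sample_averageZ.
have : sample_average y (N_ n) L * (2 * eta) <= (M + 1) * (2 * eta).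
  by rewrite ler_wpM2r// mulr_ge0// ltW.
by lra.
Unshelve. all: by end_near. Qed.


End averages.

(** The lower bound is the upper bound in the opposite direction. *)
Lemma uniform_average_cvg (y : nat -> X) :
  (forall i j l, sample_average y n (local_sup i j l) @[n --> \oo]
     --> \int[mu]_x local_sup i j l x) ->
  sample_average y n L @[n --> \oo] --> \int[mu]_x L x ->
  forall (w_ : nat -> W) (w : W) (h_ : nat -> W) (h : W) (N_ : nat -> nat),
  (forall n, W0 (w_ n)) -> W0 w -> w_ n @[n --> \oo] --> w -> h_ n @[n --> \oo] --> h ->
  N_ n @[n --> \oo] --> \oo ->
  sample_average y (N_ n) (fun x => DJ (w_ n) x (h_ n) : R) @[n --> \oo]
    --> \int[mu]_x (DJ w x h : R).
Proof.
move=> HG HL w_ w h_ h N_ W0w_ W0w w_w h_h N_oo.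
have iDJ : mu.-integrable [set: X] (EFin \o (fun x => DJ w x h : R)).
  exact: (integrable_DJ DJ_measurable DJ_bound L_integrable).
apply/cvgrPdist_le => eps eps0.
have Nh_h : - h_ n @[n --> \oo] --> - h by exact: cvgN.
near=> n.
have up : sample_average y (N_ n) (fun x => DJ (w_ n) x (h_ n) : R)
    <= \int[mu]_x (DJ w x h : R) + eps.
  by near: n; exact: uniform_average_le.
have : sample_average y (N_ n) (fun x => DJ (w_ n) x (- h_ n) : R)
    <= \int[mu]_x (DJ w x (- h) : R) + eps.
  by near: n; apply: uniform_average_le Nh_h _ eps0.
have -> : \int[mu]_x (DJ w x (- h) : R) = - \int[mu]_x (DJ w x h : R).
  rewrite -mulN1r -RintegralZl//; apply: eq_Rintegral => x _.
  by rewrite linearN mulN1r.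
have -> : sample_average y (N_ n) (fun x => DJ (w_ n) x (- h_ n) : R) =
    - sample_average y (N_ n) (fun x => DJ (w_ n) x (h_ n) : R).
  rewrite /sample_average -mulrN -sumrN; congr (_ * _).
  by apply: eq_bigr => i _; rewrite linearN.
by move=> lo; rewrite ler_norml; apply/andP; split; lra.
Unshelve. all: by end_near. Qed.
End uniform_law.

(** The quantifiers over the points and directions come after the almost sure
    event, because these depend on the sample in the application. *)
Lemma uniform_law_of_large_numbers (R : realType) d d' (Omega : measurableType d)
    (P : probability Omega R) (X : measurableType d') (mu : probability X R)
    (xs : nat -> {RV P >-> X}) (W : normedModType R) (J : W -> X -> R) (W0 : set W)
    (L : X -> R) :
  independent xs ->
  (forall i (A : set X), measurable A -> distribution P (xs i) A = mu A) ->
  separable W -> open W0 ->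
  (forall w h, W0 w ->
    measurable_fun [set: X] (fun x => frechet (J ^~ x : W -> R^o) w h : R)) ->
  (forall x, {within W0, continuous (frechet (J ^~ x : W -> R^o))}) ->
  (forall w x, W0 w -> `|frechet (J ^~ x : W -> R^o) w| <= L x) ->
  (forall x, 0 <= L x) ->
  mu.-integrable [set: X] (EFin \o L) ->
  {ae P, forall omega, forall (w_ : nat -> W) (w : W) (h_ : nat -> W) (h : W) (N_ : nat -> nat),
    (forall n, W0 (w_ n)) -> W0 w -> w_ n @[n --> \oo] --> w ->
    h_ n @[n --> \oo] --> h -> N_ n @[n --> \oo] --> \oo ->
    sample_average (fun i => xs i omega) (N_ n)
      (fun x => frechet (J ^~ x : W -> R^o) (w_ n) (h_ n) : R) @[n --> \oo]
    --> \int[mu]_x (frechet (J ^~ x : W -> R^o) w h : R)}.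
Proof.
move=> xs_indep xs_law /dense_sequence[ws ws_dense] oW0 mDJ cDJ bDJ L0 iL.
have mL := measurable_L iL.
have aG : {ae P, forall omega, forall i j l,
    sample_average (fun i => xs i omega) n (local_sup J W0 L ws i j l) @[n --> \oo]
     --> \int[mu]_x local_sup J W0 L ws i j l x}.
  apply: ae_foralln => i; apply: ae_foralln => j; apply: ae_foralln => l.
  apply: (strong_law xs_indep xs_law (g := fun x => L x * `|ws l|)).
  - exact: (measurable_local_sup mDJ bDJ L0 iL).
  - exact: measurable_funM.
  - by move=> x; exact: local_sup_bound.
  - exact: integrable_L_scale.
have aL : {ae P, forall omega,
    sample_average (fun i => xs i omega) n L @[n --> \oo] --> \int[mu]_x L x}.
  exact: (strong_law_ge0 xs_indep xs_law).
apply: filterS2 aG aL => omega HG HL w_ w h_ h N_ *.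
exact: (uniform_average_cvg oW0 mDJ cDJ bDJ L0 iL ws_dense HG HL).
Qed.

(** * Passing to the limit in the optimality conditions *)

(** The frequency with which the sample visits a ball tends to the mass of the
    ball, which is positive: otherwise the complement would be a closed set of
    probability one missing a point of the support. *)
Lemma sample_dense (R : realType) d d' (Omega : measurableType d)
    (P : probability Omega R) (Xi : measurableMetricType R d') (mu : probability Xi R)
    (xs : nat -> {RV P >-> Xi}) :
  independent xs ->
  (forall i (A : set Xi), measurable A -> distribution P (xs i) A = mu A) ->
  separable Xi -> borel_completion mu -> law_support mu = [set: Xi] ->
  {ae P, forall omega, forall (x : Xi) (e : R), 0 < e -> exists i, ball x e (xs i omega)}.
Proof.
move=> xs_indep xs_law /dense_sequence[s sd] bmu supp.
pose O n m : set Xi := (ball (s n) m.+1%:R^-1)^°.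
have O_open n m : open (O n m) by exact: open_interior.
have mO n m : measurable (O n m).
  apply/bmu; exists (O n m), (O n m); split=> //; try exact: sub_sigma_algebra.
  by rewrite setDv measure0.
have On n m : O n m (s n).
  by apply: nbhsx_ballx; rewrite invr_gt0 ltr0n.
have muO n m : mu (O n m) != 0%E.
  apply/eqP => muO0.
  have : law_support mu (s n) by rewrite supp.
  move=> /(_ (~` (O n m))); apply => //; split; first exact: open_closedC.
  by rewrite probability_setC// [X in (1 - X)%E](muO0 : _ = 0%E) sube0.
have HO n m : {ae P, forall omega, exists i, O n m (xs i omega)}.
  have m1 : measurable_fun [set: Xi] (\1_(O n m) : Xi -> R) by exact: measurable_indic.
  have := @strong_law _ _ _ _ _ _ mu xs xs_indep xs_law (\1_(O n m)) (cst 1) m1 (measurable_cst _).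
  have b1 x : `|\1_(O n m) x| <= cst 1 x :> R.
    by rewrite indicE /=; case: (_ \in _); rewrite ?normr1 ?normr0.
  have i1 : mu.-integrable [set: Xi] (EFin \o cst 1).
    by apply: (@bounded_integrable _ _ _ _ _ 1) => // x; rewrite normr1.
  move=> /(_ b1 i1); apply: filterS => omega H; apply: contrapT => nO.
  have S0 : (fun N => N%:R^-1 * sample_sum xs (\1_(O n m)) N omega) = (fun=> 0 : R).
    apply/funext => N; rewrite /sample_sum big1 ?mulr0// => i _.
    by rewrite indicE memNset// => Oi; apply: nO; exists i.
  move: H; rewrite S0 => H0.
  have E0 : 0 = \int[mu]_x \1_(O n m) x :> R.
    by rewrite -(cvg_lim (@Rhausdorff R) H0) lim_cst.
  have E1 : \int[mu]_x \1_(O n m) x = fine (mu (O n m)) :> R.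
    by rewrite /Rintegral integral_indic// setIT.
  move/eqP: (muO n m); apply; rewrite -(@fineK _ (mu (O n m))); last exact: fin_num_measure.
  by rewrite -E1 -E0.
have := ae_foralln (fun n => ae_foralln (HO n)); apply: filterS => omega H x e e0.
have e2 : 0 < e / 2 by rewrite divr_gt0.
have [m me] : exists m, m.+1%:R^-1 < e / 2.
  exists (Num.truncn (e / 2)^-1); rewrite invf_plt ?posrE//; exact: truncnS_gt.
have [n xn] := sd x (e / 2) e2.
have [i Oi] := H n m; exists i.
rewrite (splitr e); apply: ball_triangle xn _.
exact: le_ball (ltW me) _ (interior_subset Oi).
Qed.

Section frechet_averages.
Context (R : realType) (V : normedModType R).

Lemma frechetD (f g : V -> R^o) x h : differentiable f x -> differentiable g x ->
  frechet (f + g) x h = frechet f x h + frechet g x h.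
Proof.
move=> df dg; have dfg : differentiable (f + g) x by exact: differentiableD.
pose ev (F : V -> R^o) := F h.
apply: etrans (congr1 ev (frechetE dfg)) (etrans (congr1 ev (diffD df dg)) _).
exact: esym (congr2 +%R (congr1 ev (frechetE df)) (congr1 ev (frechetE dg))).
Qed.

Lemma frechetZ (f : V -> R^o) (c : R) x h : differentiable f x ->
  frechet (c *: f) x h = c * frechet f x h.
Proof.
move=> df; have dcf : differentiable (c *: f) x by exact: differentiableZ.
pose ev (F : V -> R^o) := F h.
apply: etrans (congr1 ev (frechetE dcf)) (etrans (congr1 ev (diffZ c df)) _).
exact: esym (congr1 ( *%R c) (congr1 ev (frechetE df))).
Qed.

Lemma frechet_sum (f_ : nat -> V -> R^o) n x :
  (forall i, differentiable (f_ i) x) ->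
  differentiable (fun v => \sum_(i < n) f_ i v : R^o) x /\
  forall h, frechet (fun v => \sum_(i < n) f_ i v : R^o) x h = \sum_(i < n) frechet (f_ i) x h.
Proof.
move=> df; elim: n => [|n [IHd IHE]].
  have -> : (fun v => \sum_(i < 0) f_ i v : R^o) = cst (0 : R^o).
    by apply/funext => v; rewrite big_ord0.
  split=> [|h]; first exact: differentiable_cst.
  rewrite big_ord0 frechetE; last exact: differentiable_cst.
  by rewrite diff_cst.
have -> : (fun v => \sum_(i < n.+1) f_ i v : R^o) =
    (fun v => \sum_(i < n) f_ i v : R^o) + f_ n.
  by apply/funext => v; rewrite big_ord_recr.
split=> [|h]; first exact: differentiableD.
rewrite big_ord_recr /=; apply: etrans (frechetD h IHd (df n)) _.
exact: (congr1 (fun c => c + frechet (f_ n) x h) (IHE h)).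
Qed.

End frechet_averages.

(** If the ball of radius d around r lies in K, then l (r + k) <= 0 for all k in
    the ball of radius d around 0. *)
Lemma polar_bounded (R : realType) (V : normedModType R) (K : set V) :
  K° !=set0 -> exists r : V, exists2 rho : R, 0 < rho &
    forall l, polar K l -> forall e, `|l e| <= rho * - l r * `|e|.
Proof.
move=> [r /nbhs_ballP[d /= d0 Kd]].
exists r, (2 / d) => [|l Kl e]; first by rewrite divr_gt0.
have bnd k : `|k| < d -> l k <= - l r.
  move=> kd; have := Kl (r + k); rewrite linearD -lerBrDl sub0r; apply; apply: Kd.
  by rewrite -ball_normE /= opprD addrA subrr sub0r normrN.
have [->|e0] := eqVneq e 0; first by rewrite linear0 !normr0 mulr0.
have ne0 : 0 < `|e| by rewrite normr_gt0.
pose c := d / 2 / `|e|.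
have c0 : 0 < c by rewrite !divr_gt0.
have ck : `|c *: e| < d.
  rewrite normrZ gtr0_norm// /c divfK ?gt_eqF//; lra.
have h1 := bnd _ ck; have h2 := bnd (- (c *: e)); rewrite normrN in h2.
have {}h2 := h2 ck.
rewrite -(ler_pM2l c0) -{1}(gtr0_norm c0) -normrM.
have -> : c * (2 / d * - l r * `|e|) = - l r.
  by rewrite /c; field; rewrite !gt_eqF.
rewrite ler_norml -lerNl.
have E : c * l e = l (c *: e) by rewrite linearZ.
by rewrite E; move: h2; rewrite linearN => h2; apply/andP; split.
Qed.

Lemma dual_pairing_cvg (R : realType) (V : normedModType R) (l_ : nat -> dual V) (l : dual V)
    (e_ : nat -> V) (e : V) (C : R) :
  (\forall n \near \oo, forall k, `|l_ n k| <= C * `|k|) ->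
  weakstar_cvg l_ l -> e_ n @[n --> \oo] --> e ->
  (l_ n (e_ n) : R) @[n --> \oo] --> (l e : R).
Proof.
move=> bC ll ee; apply/cvgrPdist_le => eps eps0.
have C0 : 0 < `|C| + 1 by rewrite ltr_wpDl.
near=> n.
have h1 : `|(l e : R) - l_ n e| <= eps / 2.
  near: n; move/cvgrPdist_le: (ll e); apply; exact: divr_gt0.
have h2 : `|e - e_ n| <= eps / 2 / (`|C| + 1).
  by near: n; move/cvgrPdist_le: ee; apply; rewrite !divr_gt0.
have h3 k : `|l_ n k| <= C * `|k| by move: k; near: n.
rewrite -(subrKA (l_ n e : R)); apply: le_trans (ler_normD _ _) _.
rewrite (splitr eps); apply: lerD => //.
rewrite -linearB; apply: le_trans (h3 _) _.
apply: le_trans (_ : (`|C| + 1) * `|e - e_ n| <= _).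
  by apply: ler_wpM2r => //; apply: le_trans (ler_norm _) _; rewrite lerDl.
by rewrite -ler_pdivlMl// mulrC.
Unshelve. all: by end_near. Qed.

(** If B were unbounded, rescaling would give h n of norm at most 1/(n+1) with
    |B (h n)| > 1; but norm convergence to 0 implies weak* convergence. *)
Lemma seq_continuous_linear (R : realType) (Z W : normedModType R)
    (B : {linear dual Z -> W}) :
  (forall (u : nat -> dual Z) (l : dual Z),
     weakstar_cvg u l -> B (u n) @[n --> \oo] --> B l) -> continuous B.
Proof.
move=> BB; have [C BC] : exists C, forall h, `|B h| <= C * `|h|; last first.
  by have /asboolP[] := bounded_linear_bop (linearP B) BC.
apply: contrapT => nB.
have /choice[h H] n : exists h : dual Z, `|h| <= n.+1%:R^-1 /\ 1 < `|B h|.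
  apply: contrapT => nh; apply: nB; exists n.+1%:R => h.
  rewrite leNgt; apply/negP => Bh; apply: nh.
  have h0 : 0 < `|h|.
    rewrite normr_gt0; apply/eqP => h0; move: Bh.
    by rewrite h0 linear0 !normr0 mulr0 ltxx.
  have n0 : 0 < n.+1%:R * `|h| by rewrite mulr_gt0// ltr0n.
  exists ((n.+1%:R * `|h|)^-1 *: h); split.
    by rewrite normrZ gtr0_norm ?invr_gt0// invfM mulrAC -mulrA mulfV ?mulr1// gt_eqF.
  by rewrite linearZ normrZ gtr0_norm ?invr_gt0// -ltr_pdivrMl ?invr_gt0// invrK mulr1.
have h0 : weakstar_cvg h 0.
  move=> v; apply/cvgrPdist_le => e e0.
  have v0 : 0 < e / (`|v| + 1) by rewrite divr_gt0// ltr_wpDl.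
  near=> n; rewrite sub0r normrN; apply: le_trans (bop_norm_ge _ _) _.
  have [hn _] := H n.
  have nv : n.+1%:R^-1 < e / (`|v| + 1) by near: n; exact: (near_infty_natSinv_lt (PosNum v0)).
  apply: le_trans (_ : e / (`|v| + 1) * `|v| <= _).
    by apply: ler_wpM2r => //; apply: ltW; exact: le_lt_trans nv.
  by rewrite -mulrA ger_pMr// ler_pdivrMl ?mulr1 ?lerDl// ltr_wpDl.
have := BB h 0 h0; rewrite linear0 => /cvgrPdist_le/(_ _ (@ltr01 R))[n _ /(_ n (leqnn n))].
by rewrite sub0r normrN leNgt => /negP; apply; case: (H n).
Unshelve. all: by end_near. Qed.

Lemma sampled_constraint_limit (R : realType) (Xi : topologicalType) (X0 : nat -> Xi)
    (E : normedModType R) (K : set E) (r : Xi -> E) :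
  closed K -> continuous r ->
  (forall O : set Xi, open O -> O !=set0 -> exists i, O (X0 i)) ->
  (forall i, K (r (X0 i))) -> forall x, K (r x).
Proof.
move=> cK cr dX Kr x; apply: contrapT => nK.
have oO : open (r @^-1` (~` K)).
  by apply: open_comp => [? _|]; [exact: cr|exact: closed_openC].
have [i] := dX _ oO (ex_intro _ x nK).
by apply; exact: Kr.
Qed.

Lemma le_limn_einf (R : realType) (a b : nat -> \bar R) :
  (forall n, (a n <= b n)%E) -> (limn_einf a <= limn_einf b)%E.
Proof.
move=> ab; rewrite !limn_einf_lim; apply: lee_lim; try exact: is_cvg_einfs.
apply: nearW => n; apply/ereal_infP => _ [k nk <-].
by apply: ge_ereal_inf; exists (a k) => //; exists k.
Qed.

(** The inequality psi (u_ n) <= psi v - m_ n (v - u_ n) has a convergent right-hand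
    side, and the lower limit of the left-hand side is at least psi u. *)
Lemma subdifferential_limit (R : realType) (V : normedModType R) (psi : dual V -> \bar R)
    (u_ : nat -> dual V) (u : dual V) (m_ : nat -> dual (dual V)) (m : dual (dual V)) :
  (forall v, (0 <= psi v)%E) -> weakstar_seq_lsc psi -> weakstar_cvg u_ u ->
  dom psi u -> (forall n, subdifferential psi (u_ n) (m_ n)) ->
  (forall v, (m_ n (v - u_ n) : R) @[n --> \oo] --> (m (v - u) : R)) ->
  subdifferential psi u m.
Proof.
move=> psi0 lsc uu du sub mm; split=> // v.
have [->|vy] := eqVneq (psi v) +oo%E; first exact: leey.
have vfin : psi v \is a fin_num by rewrite ge0_fin_numE// lt_neqAle vy leey.
have ufin : psi u \is a fin_num by rewrite ge0_fin_numE.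
have H n : (psi (u_ n) <= (fine (psi v) - (m_ n (v - u_ n) : R))%:E)%E.
  have [dun /(_ v)] := sub n.
  have unfin : psi (u_ n) \is a fin_num by rewrite ge0_fin_numE.
  rewrite -[in X in X -> _](fineK unfin) -[in X in X -> _](fineK vfin) -EFinD lee_fin.
  by rewrite -lerBrDr -lee_fin (fineK unfin).
have cv : (fine (psi v) - (m_ n (v - u_ n) : R))%:E @[n --> \oo]
    --> (fine (psi v) - (m (v - u) : R))%:E.
  by apply: cvg_EFin; [exact: nearW|apply: cvgB; [exact: cvg_cst|exact: mm]].
have : (psi u <= (fine (psi v) - (m (v - u) : R))%:E)%E.
  apply: le_trans (lsc _ _ uu) _.
  rewrite -(cvg_limn_einf_sup cv).1; exact: le_limn_einf.
rewrite -[in X in X -> _](fineK ufin) lee_fin lerBrDr => Hf.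
by rewrite -(fineK ufin) -(fineK vfin) -EFinD lee_fin.
Qed.

Lemma contfun_eval_cvg (R : realType) (X : topologicalType) (hX : compact [set: X])
    (E : normedModType R) (f_ : nat -> contfun hX E) (f : contfun hX E) x :
  f_ n @[n --> \oo] --> f -> f_ n x @[n --> \oo] --> f x.
Proof.
move=> ff; apply/cvgrPdist_le => e e0.
move/cvgrPdist_le: ff => /(_ _ e0); apply: filterS => n; apply: le_trans.
exact: (contfun_norm_ge (f - f_ n) x).
Qed.

Theorem theorem4p7 (R : realType) (d d' : measure_display)
  (* probabilistic setting *)
  (Omega : measurableType d) (P : probability Omega R)
  (P_complete : measure_is_complete P)
  (Xi : measurableMetricType R d') (Xi_separable : separable Xi)
  (xi : {RV P >-> Xi})
  (Xi_borel : borel_completion (distribution P xi))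
  (law_complete : measure_is_complete (distribution P xi))
  (xis : nat -> {RV P >-> Xi})
  (xis_indep : independent xis)
  (xis_law : forall i (A : set Xi), measurable A ->
     distribution P (xis i) A = distribution P xi A)
  (* (G1): [E], [E0] stand for R, R_0, and [dual Z] for U *)
  (W E E0 Z : completeNormedModType R)
  (W_separable : separable W) (E_separable : separable E)
  (E0_separable : separable E0) (Z_separable : separable Z)
  (iota : {linear E -> E0}) (iota_inj : injective iota)
  (iota_cont : continuous iota)
  (* (G2) *)
  (B : {linear dual Z -> W})
  (B_cont : forall (u : nat -> dual Z) (l : dual Z),
     weakstar_cvg u l -> B (u n) @[n --> \oo] --> B l)
  (* (G3) *)
  (J : W -> Xi -> R) (J_ge0 : forall w x, 0 <= J w x)
  (J_lsc : random_lsc J)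
  (* (G5) *)
  (psi : dual Z -> \bar R) (psi_ge0 : forall u, (0 <= psi u)%E)
  (psi_proper : dom psi !=set0)
  (psi_convex : econvex psi)
  (psi_lsc : weakstar_seq_lsc psi)
  (psi_bounded : bounded_set (dom psi))
  (psi_closed : weakstar_seq_closed (dom psi))
  (* (G4) *)
  (GG : W -> Xi -> E0)
  (GG_caratheodory : caratheodory_on [set: W] GG)
  (GG_range : forall (u : dual Z) x, range iota (GG (B u) x))
  (GG_caratheodory_E : caratheodory_on (B @` dom psi)
     (fun w x => in_sub iota (GG w x)))
  (K : set E) (K_neq0 : K !=set0) (K_closed : closed K)
  (K_convex : convex_set (K : set (convex_lmodType E))) (K_cone : cone K)
  (* (G6) *)
  (feasible : exists u : dual Z,
     {ae distribution P xi, forall x, K (in_sub iota (GG (B u) x))} /\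
     (eF B J xi u + psi u < +oo)%E)
  (* (S1) *)
  (Xi_compact : compact [set: Xi])
  (* (S2) *)
  (U0 : set (dual Z)) (W0 : set W) (U0_open : open U0) (W0_open : open W0)
  (dom_U0 : dom psi `<=` U0) (B_U0 : B @` U0 `<=` W0)
  (J_C1 : forall x, continuously_differentiable_on W0 (J ^~ x : W -> R^o))
  (DJ_measurable : forall w, W0 w ->
     borel_measurable (fun x => frechet (J ^~ x : W -> R^o) w))
  (L : Xi -> R) (L_ge0 : forall x, 0 <= L x)
  (L_integrable : (distribution P xi).-integrable [set: Xi] (EFin \o L))
  (DJ_bound : forall w x, W0 w -> `|frechet (J ^~ x : W -> R^o) w| <= L x)
  (* (S3) *)
  (GG_C1 : forall x, continuously_differentiable_on W0 (GG ^~ x))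
  (DGG_measurable : forall w, W0 w ->
     borel_measurable (fun x => frechet (GG ^~ x) w))
  (GG_continuous : {within (B @` U0) `*` [set: Xi],
     continuous (fun p : W * Xi => in_sub iota (GG p.1 p.2))})
  (DGG_continuous : exists DG : W -> Xi -> bop W E,
     (forall w x h, (B @` U0) w -> iota (DG w x h) = frechet (GG ^~ x) w h) /\
     {within (B @` U0) `*` [set: Xi],
       continuous (fun p : W * Xi => DG p.1 p.2)})
  (* specific assumptions *)
  (Xi_support : law_support (distribution P xi) = [set: Xi])
  (calK_int : (calK Xi_compact K)° !=set0)
  (us : nat -> Omega -> dual Z)
  (lams : nat -> Omega -> dual (contfun Xi_compact E))
  (us_KKT : {ae P, forall w, forall N, (0 < N)%N ->
     SAA_KKT_point iota B J xis psi GG K N w (us N w) (lams N w)})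
  (us_cvg : {ae P, forall w, exists ubar : dual Z,
     weakstar_cvg (fun N => us N w) ubar /\
     exists2 uhat : dual Z, dom psi uhat &
       (calK Xi_compact K)°
         (calG Xi_compact iota B GG ubar +
          frechet (calG Xi_compact iota B GG) ubar (uhat - ubar))}) :
  {ae P, forall w, forall k : nat -> nat, {homo k : m n / (m < n)%N} ->
     forall (u : dual Z) (lam : dual (contfun Xi_compact E)),
       weakstar_cvg (fun n => us (k n) w) u ->
       weakstar_cvg (fun n => lams (k n) w) lam ->
       KKT_point iota B J xi psi GG K u lam}.
Proof.
pose mu : probability Xi R := distribution P xi.
have cB : continuous B := seq_continuous_linear B_cont.
have [DG [DGE cDG]] := DGG_continuous.
have BW0 v : U0 v -> W0 (B v) by move=> U0v; apply: B_U0; exists v.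
have J_meas w : measurable_fun [set: Xi] (J w) := random_lsc_measurable w J_lsc.
have mDJ w h : W0 w -> measurable_fun [set: Xi] (fun x => frechet (J ^~ x : W -> R^o) w h : R).
  by move=> W0w; apply: borel_measurable_apply; exact: DJ_measurable.
have dJ x w : W0 w -> differentiable (J ^~ x : W -> R^o) w := (J_C1 x).1 w.
have cDJ x := (J_C1 x).2.
have dGG x w : W0 w -> differentiable (GG ^~ x) w := (GG_C1 x).1 w.
have FE : F B J xi = (fun v => \int[mu]_x J (B v) x).
  apply/funext => v; rewrite /F /eF /Rintegral unlock /= ge0_integral_distribution//.
  - by apply/measurable_EFinP; exact: J_meas.
  - by move=> x; rewrite lee_fin.
have [u1 [_ u1fin]] := feasible.
have eF1 : (0 <= eF B J xi u1)%E by apply: expectation_ge0 => w.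
have du1 : dom psi u1 by apply: le_lt_trans u1fin; rewrite leeDr.
have iJ1 : mu.-integrable [set: Xi] (EFin \o J (B u1)).
  apply/integrableP; split; first by apply/measurable_EFinP.
  under eq_integral do rewrite /= ger0_norm//.
  rewrite ge0_integral_distribution//=; last 2 first.
  - by apply/measurable_EFinP.
  - by move=> x; rewrite lee_fin.
  move: u1fin; rewrite /eF unlock; apply: le_lt_trans.
  by rewrite leeDl.
have iJ u : dom psi u -> mu.-integrable [set: Xi] (EFin \o J (B u)).
  move=> du; rewrite -(subrK (B u1) (B u)) addrC.
  apply: (integrable_J_segment J_meas dJ DJ_bound L_integrable) => // t t01.
  rewrite -linearB -linearZ -linearD; apply/BW0/dom_U0.
  have -> : u1 + t *: (u - u1) = t *: u + (1 - t) *: u1.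
    by rewrite scalerBr scalerBl scale1r addrCA.
  rewrite /dom /=; apply: le_lt_trans (psi_convex t u u1 t01) _.
  case/andP: t01 => t0 t1.
  have fin v : dom psi v -> psi v \is a fin_num by move=> dv; rewrite ge0_fin_numE.
  by rewrite -(fineK (fin _ du)) -(fineK (fin _ du1)) -!EFinM -EFinD ltry.
have dense_ae := sample_dense xis_indep xis_law Xi_separable Xi_borel Xi_support.
have ulln := uniform_law_of_large_numbers xis_indep xis_law W_separable W0_open mDJ cDJ
  DJ_bound L_ge0 L_integrable.
have KKTG u := calG_frechet Xi_compact iota_inj iota_cont cB U0_open B_U0 GG_range dGG
  GG_continuous DGE cDG (u := u).
move: us_KKT dense_ae ulln; apply: filterS3 => omega HK Hdense Hlln k k_homo u lam uu ll.
have kn n : (n <= k n)%N.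
  elim: n => // n IH; apply: leq_ltn_trans IH _; exact: k_homo.
(* The shift by one avoids the empty sample, for which nothing is assumed. *)
pose N_ n := k n.+1.
have N_gt0 n : (0 < N_ n)%N by apply: leq_trans (kn n.+1).
pose u_ n := us (N_ n) omega; pose l_ n := lams (N_ n) omega.
have {}uu : weakstar_cvg u_ u.
  by move=> v; have := uu v; rewrite -(cvg_shiftS (fun n => us (k n) omega v)).
have {}ll : weakstar_cvg l_ lam.
  by move=> v; have := ll v; rewrite -(cvg_shiftS (fun n => lams (k n) omega v)).
have N_oo : N_ n @[n --> \oo] --> \oo.
  move=> A [M _ MA]; exists M => // n /= Mn; apply: MA => /=.
  exact: leq_trans Mn (ltnW (kn n.+1)).
have SAA n := HK (N_ n) (N_gt0 n).
have du_ n : dom psi (u_ n) by have [[m [] ]] := SAA n.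
have du : dom psi u by exact: psi_closed uu.
have U0u : U0 u by exact: dom_U0.
have U0u_ n : U0 (u_ n) by exact: dom_U0.
have Bu : B (u_ n) @[n --> \oo] --> B u by exact: B_cont.
have Gu : calG Xi_compact iota B GG (u_ n) @[n --> \oo] --> calG Xi_compact iota B GG u.
  exact: calG_cvg.
have [dF FfE] := expectation_frechet J_meas dJ mDJ DJ_bound L_integrable cB U0_open BW0 U0u (iJ u du).
have [dG GfE] := KKTG u U0u.
have [r0 [rho rho0 Hrho]] := polar_bounded calK_int.
have polar_n n : polar (calK Xi_compact K) (l_ n) by have [] := SAA n.
have lC : \forall n \near \oo, forall e, `|l_ n e| <= (rho * (`|lam r0| + 1)) * `|e|.
  have /cvgrPdist_le/(_ _ (@ltr01 R)) := ll r0.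
  apply: filterS => n H e; apply: le_trans (Hrho _ (polar_n n) e) _.
  apply: ler_wpM2r => //; apply: ler_wpM2l; first exact: ltW.
  apply: le_trans (ler_norm _) _; rewrite normrN -lerBlDl.
  by apply: le_trans (lerB_dist _ _) _; rewrite distrC.
have pairing := dual_pairing_cvg lC ll.
split; [by rewrite FE|exact: dG|split].
- apply: (sampled_constraint_limit (X0 := fun i => xis i omega) K_closed).
  + exact: contfun_continuous.
  + move=> O oO [x Ox].
    have /nbhs_ballP[e /= e0 He] : nbhs x O by exact: open_nbhs_nbhs.
    by have [i xi_i] := Hdense x e e0; exists i; exact: He.
  + move=> i; have Gi := contfun_eval_cvg (x := xis i omega) Gu.
    apply: (closed_cvg K K_closed _ _ Gi).
    near=> n.
    have iN : (i < N_ n)%N by apply: leq_trans (kn n.+1); rewrite ltnS; near: n; exact: nbhs_infty_ge.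
    by have [_ _ _ HKi] := SAA n; exact: (HKi (Ordinal iN)).
- have FhatE v N h : U0 v -> frechet (Fhat B J xis N omega) v h =
      sample_average (fun i => xis i omega) N (fun x => frechet (J ^~ x : W -> R^o) (B v) (B h) : R).
    move=> U0v.
    have dJB i := frechet_comp_linear cB (dJ (xis i omega) (B v) (BW0 v U0v)).
    pose f_ i : dual Z -> R^o := (J ^~ (xis i omega) : W -> R^o) \o B.
    have df_ i : differentiable (f_ i) v by exact: (dJB i).1.
    have [dS SE] := frechet_sum N df_.
    apply: etrans (frechetZ N%:R^-1 h dS) _.
    rewrite /sample_average SE; congr (_ * _); apply: eq_bigr => i _.
    exact: (dJB i).2.
  have /choice[m_ Hm] n : exists m, subdifferential psi (u_ n) m /\
     frechet (Fhat B J xis (N_ n) omega) (u_ n) + m +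
     adjoint (frechet (calG Xi_compact iota B GG) (u_ n)) (l_ n) = 0.
    by have [[m sm Em] _ _ _] := SAA n; exists m.
  rewrite FE; set Phi := (fun v => _) in dF FfE *.
  pose A := adjoint (frechet (calG Xi_compact iota B GG) u) lam.
  exists (- (frechet Phi u + A)); last first.
    by rewrite opprD addrA subrr sub0r addNr.
  apply: (subdifferential_limit psi_ge0 psi_lsc uu du (fun n => (Hm n).1)) => v.
  have Bv : B (v - u_ n) @[n --> \oo] --> B (v - u).
    rewrite linearB; under eq_fun do rewrite linearB.
    by apply: cvgB => //; exact: cvg_cst.
  have cF := Hlln (fun n => B (u_ n)) (B u) _ _ N_ (fun n => BW0 _ (U0u_ n)) (BW0 _ U0u) Bu Bv N_oo.
  have cG : l_ n (frechet (calG Xi_compact iota B GG) (u_ n) (v - u_ n)) @[n --> \oo]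
      --> lam (frechet (calG Xi_compact iota B GG) u (v - u)).
    apply: pairing.
    exact: (frechet_calG_cvg iota_inj iota_cont cB U0_open B_U0 GG_range dGG GG_continuous DGE cDG).
  have mE n : (m_ n (v - u_ n) : R) =
      - (sample_average (fun i => xis i omega) (N_ n)
           (fun x => frechet (J ^~ x : W -> R^o) (B (u_ n)) (B (v - u_ n)) : R) +
         (l_ n (frechet (calG Xi_compact iota B GG) (u_ n) (v - u_ n)) : R)).
    have := congr1 (fun f : dual (dual Z) => (f (v - u_ n) : R)) (Hm n).2.
    move=> H; have {}H : (frechet (Fhat B J xis (N_ n) omega) (u_ n) (v - u_ n) : R) +
      (m_ n (v - u_ n) : R) +
      (l_ n (frechet (calG Xi_compact iota B GG) (u_ n) (v - u_ n)) : R) = 0 := H.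
    have := FhatE (u_ n) (N_ n) (v - u_ n) (U0u_ n).
    have solve (a a' m c : R) : a + m + c = 0 -> a = a' -> m = - (a' + c) by lra.
    exact: (solve _ _ _ _ H).
  have -> : ((- (frechet Phi u + A)) (v - u) : R) =
     - (\int[mu]_x (frechet (J ^~ x : W -> R^o) (B u) (B (v - u)) : R) +
        (lam (frechet (calG Xi_compact iota B GG) u (v - u)) : R)).
    exact: (congr1 (fun c : R => - (c + (lam (frechet (calG Xi_compact iota B GG) u (v - u)) : R)))
      (FfE (v - u))).
  rewrite (funext mE); apply: cvgN; apply: cvgD; [exact: cF|exact: cG].
- move=> r Kr; apply: (closed_cvg (fun x : R => x <= 0) _ _ _ (ll r)).
  + exact: closed_le.
  + by apply: nearW => n; exact: polar_n.
- have := pairing _ _ Gu; rewrite (_ : (fun n => _) = (fun=> 0)).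
    by move=> H; rewrite -(cvg_lim (@Rhausdorff R) H) lim_cst.
  by apply/funext => n; have [] := SAA n.
Unshelve. all: by end_near. Qed.
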